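(* Let $U\subset P(m)$ be a shifted order ideal, $t\ge 0$ an integer, and let $\Delta_t(U)$ be the squeezed complex with $h$-vector $(h_0,h_1,\ldots,h_d)$, where $d=d_{\max}(U)$. Let $\alpha$ be the least degree in which the $h$-vector attains its maximum, that is, $$\alpha=\min\{i : h_i=\max\{h_k : 0\le k\le d\}\}.$$ Then the Stanley-Reisner ring $\mathbb{K}[\Delta_t(U)]$ has the weak Lefschetz property if and only if the following conditions are satisfied: (i) every $u\in[U]_j$ is divisible by $x_m$ for every $j>\alpha$; (ii) $x_m[G_s(U)]_{j-1}\subset[U]_j$ for every $0<j\le\alpha$.
   Context: Notation. $\mathbb{K}$ is an infinite field, $m\ge 1$, $P(m)=\mathbb{K}[x_1,\ldots,x_m]$; $[n]=\{1,\ldots,n\}$ and $[a,b]=\{c\in\mathbb{N} : a\le c\le b\}$ (empty if $a>b$). Order ideals. A monomial order ideal of $P(m)$ is a finite set $U$ of monomials of $P(m)$ closed under taking divisors; it is always assumed that $1,x_1,\ldots,x_m\in U$. $U$ is shifted if $x_iu\in U$ ($u$ a monomial) and $i<j\le m$ imply $x_ju\in U$. $d_{\max}(U)$ is the maximal degree of a monomial in $U$. For a set $S$ of monomials, $[S]_k$ is the set of monomials of degree $k$ in $S$. Shift generators. A monomial $x_ju\in P(m)$ is obtained by a shift move from $x_iu$ if $j\ge i$. A monomial is shift-generated by a monomial $v$ if it can be obtained from $v$ by a finite sequence of shift moves. A set $G_s$ is a set of shift generators of a shifted order ideal $U$ if the set of monomials that are shift-generated by some monomial in $G_s$ is $U$.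 $G_s(U)$ denotes the smallest set of shift generators of $U$. Squeezed complexes. Put $d=d_{\max}(U)$ and let $t\ge 0$ be an integer. For $u=x_{i_1}\cdots x_{i_s}\in U$ with $i_1\le\cdots\le i_s$ set $$F_t(u)=\bigcup_{\ell=1}^s\{i_\ell+2(\ell-1),\,i_\ell+2\ell-1\}\cup[m+2s+1,\,m+t+d]\quad\text{if } s\le t,$$ $$F_t(u)=\bigcup_{\ell=1}^t\{i_\ell+2(\ell-1),\,i_\ell+2\ell-1\}\cup\bigcup_{\ell=t+1}^s\{i_\ell+\ell+t-1\}\cup[m+t+s+1,\,m+t+d]\quad\text{if } s\ge t.$$ Each $F_t(u)$ is a $(d+t)$-subset of $[m+t+d]$. $\Delta_t(U)$ is the pure $(d+t-1)$-dimensional simplicial complex on vertex set $[m+t+d]$ whose facets are the sets $F_t(u)$, $u\in U$. It is Cohen-Macaulay. Its $h$-vector is defined by $\sum_{i=0}^{e}f_{i-1}(z-1)^{e-i}=\sum_{i=0}^{e}h_iz^{e-i}$ with $e=d+t$ and $f_i$ the number of $i$-dimensional faces; the entries $h_i$ with $i>d$ vanish and are omitted. Weak Lefschetz property. A standard graded Cohen-Macaulay $\mathbb{K}$-algebra $A$ of Krull dimension $e$ has the weak Lefschetz property if there are a linear system of parameters $\ell_1,\ldots,\ell_e\in A$ and a linear form $\ell\in A$ such that, for $\overline{A}=A/(\ell_1,\ldots,\ell_e)A$, every multiplication map $\times\ell:[\overline{A}]_i\to[\overline{A}]_{i+1}$ has maximal rank (i.e. is injective or surjective). *)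

(* Defs.v *)
From Stdlib Require Import Relation_Operators.
From HB Require Import structures.
From mathcomp Require Import all_boot all_order all_algebra finmap.
From mathcomp.multinomials Require Import mpoly.

Set Implicit Arguments.
Unset Strict Implicit.
Unset Printing Implicit Defensive.

Import GRing.Theory.

Local Open Scope ring_scope.

(** * Monomial order ideals

   A monomial of P(m) is an element of ['X_{1..m}] (written additively), and
   the variable x_(i+1) is [U_(i)%MM] for [i : 'I_m]. *)

Section OrderIdeals.
Variable m : nat.
Implicit Types (U G : {fset 'X_{1..m}}) (u v w : 'X_{1..m}).

Definition order_ideal U : Prop :=
  [/\ forall u v, v \in U -> (u <= v)%MM -> u \in U,
      0%MM \in U
    & forall i : 'I_m, U_(i)%MM \in U].

Definition shifted U : Prop :=
  forall u (i j : 'I_m), (i < j)%N ->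
    (U_(i) + u)%MM \in U -> (U_(j) + u)%MM \in U.

Definition dmax U : nat := (\max_(u <- U) mdeg u)%N.

Definition degree_part U (k : nat) : {fset 'X_{1..m}} :=
  [fset u in U | mdeg u == k]%fset.

Definition shift_move v w : Prop :=
  exists (u : 'X_{1..m}) (i j : 'I_m),
    [/\ (i <= j)%N, v = (U_(i) + u)%MM & w = (U_(j) + u)%MM].

Definition shift_generates : 'X_{1..m} -> 'X_{1..m} -> Prop :=
  clos_refl_trans 'X_{1..m} shift_move.

Definition shift_generators G U : Prop :=
  forall w, w \in U <-> exists2 v, v \in G & shift_generates v w.

(* [G] is G_s(U).  Every set of shift generators of [U] is contained in [U],
   so considering finite sets is no restriction. *)
Definition least_shift_generators G U : Prop :=
  shift_generators G U /\
  forall G', shift_generators G' U -> (G `<=` G')%fset.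

End OrderIdeals.

(** * Squeezed complexes *)

(* i_1 <= ... <= i_s with u = x_{i_1} ... x_{i_s}, as 1-based indices. *)
Definition var_indices m (u : 'X_{1..m}) : seq nat :=
  flatten [seq nseq (u i) i.+1 | i <- enum 'I_m].

(* F_t(u) as a list of elements of {1, ..., m+t+d}, where [s] lists the
   1-based variable indices of u. *)
Definition facet_seq (m t d : nat) (s : seq nat) : seq nat :=
  let i l := nth 0%N s l.-1 in
  let pair_ l := [:: i l + 2 * (l - 1); i l + 2 * l - 1]%N in
  if (size s <= t)%N then
    flatten [seq pair_ l | l <- index_iota 1 (size s).+1] ++
    index_iota (m + 2 * size s + 1) (m + t + d).+1
  else
    flatten [seq pair_ l | l <- index_iota 1 t.+1] ++
    [seq (i l + l + t - 1)%N | l <- index_iota t.+1 (size s).+1] ++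
    index_iota (m + t + size s + 1) (m + t + d).+1.

(* The vertex k of {1, ..., m+t+d} is the ordinal of value k - 1. *)
Definition facet m (t d : nat) (u : 'X_{1..m}) : {set 'I_(m + t + d)} :=
  [set v : 'I_(m + t + d) | v.+1 \in facet_seq m t d (var_indices u)].

(* A simplicial complex on 'I_n is given by its set of faces, empty face
   included. *)
Definition squeezed_complex m (U : {fset 'X_{1..m}}) (t : nat) :
    {set {set 'I_(m + t + dmax U)}} :=
  [set A : {set 'I_(m + t + dmax U)} | [exists u : U, A \subset facet t (dmax U) (val u)]].

(** * h-vectors *)

Section HVector.
Variables (n : nat) (Delta : {set {set 'I_n}}) (e : nat).

(* [card_faces i] is f_{i-1}. *)
Definition card_faces (i : nat) : nat := #|[set A in Delta | #|A| == i]|.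

Definition h_poly : {poly int} :=
  \sum_(i < e.+1) (card_faces i)%:R *: ('X - 1) ^+ (e - i).

Definition h_entry (i : nat) : int := h_poly`_(e - i).

End HVector.

Definition squeezed_h m (U : {fset 'X_{1..m}}) (t : nat) : seq int :=
  [seq h_entry (squeezed_complex U t) (dmax U + t) i | i <- iota 0 (dmax U).+1].

(* The first position at which a (nonempty) list attains its maximum. *)
Definition first_peak (h : seq int) : nat :=
  index (\big[Order.max/head 0 h]_(x <- h) x) h.

(** * Standard graded algebras and the weak Lefschetz property

   A standard graded K-algebra is presented as A = S/I, with S = K[X_1..X_n]
   and I a homogeneous ideal, the latter given by its membership predicate.
   The component of degree i of A, or of a graded quotient of A, consists of
   the classes of the homogeneous polynomials of degree i. *)

Section StandardGraded.
Variables (K : fieldType) (n : nat).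
Local Notation S := {mpoly K[n]}.
Implicit Types (I J G : S -> Prop).

Definition ideal_gen G : S -> Prop := fun f =>
  exists s : seq (S * S),
    (forall p, p \in s -> G p.2) /\ f = \sum_(p <- s) p.1 * p.2.

Definition stanley_reisner (Delta : {set {set 'I_n}}) : S -> Prop :=
  ideal_gen (fun f => exists2 A, A \notin Delta & f = \prod_(v in A) 'X_v).

(* A strictly increasing chain p_0, ..., p_k of prime ideals of S containing
   I, that is, of prime ideals of S/I. *)
Definition prime_chain I (k : nat) (p : nat -> {pred S}) : Prop :=
  (forall i, (i <= k)%N ->
     [/\ idealr_closed (p i), prime_idealr_closed (p i)
       & forall f, I f -> f \in p i]) /\
  (forall i, (i < k)%N ->
     {subset p i <= p i.+1} /\ exists2 f, f \in p i.+1 & f \notin p i).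

Definition krull_dim I (e : nat) : Prop :=
  (exists p, prime_chain I e p) /\
  (forall k p, prime_chain I k p -> (k <= e)%N).

Definition finite_dim_quot J : Prop :=
  exists b : seq S, forall f, exists c : nat -> K,
    J (f - \sum_(i < size b) c i *: b`_i).

(* The ideal (I, theta_1, ..., theta_e) of S. *)
Definition ideal_add I e (theta : 'I_e -> S) : S -> Prop :=
  ideal_gen (fun f => I f \/ exists i, f = theta i).

Definition linear_sop I e (theta : 'I_e -> S) : Prop :=
  [/\ krull_dim I e,
      forall i, theta i \is 1.-homog
    & finite_dim_quot (ideal_add I theta)].

(* Injectivity and surjectivity of the multiplication by l from degree i to
   degree i+1 of S/J. *)
Definition mul_injective J (l : S) (i : nat) : Prop :=
  forall f, f \is i.-homog -> J (l * f) -> J f.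

Definition mul_surjective J (l : S) (i : nat) : Prop :=
  forall g, g \is i.+1.-homog -> exists2 f, f \is i.-homog & J (g - l * f).

Definition weak_lefschetz I : Prop :=
  exists (e : nat) (theta : 'I_e -> S) (l : S),
    [/\ linear_sop I theta, l \is 1.-homog
      & forall i, mul_injective (ideal_add I theta) l i \/
                  mul_surjective (ideal_add I theta) l i].

End StandardGraded.

(* Main.v *)
Require Import Defs.
From HB Require Import structures.
From mathcomp Require Import all_boot all_order all_algebra finmap zify.
From mathcomp.multinomials Require Import mpoly.
From Stdlib Require Import Relation_Operators Classical_Prop FunctionalExtensionality.

Set Implicit Arguments.
Unset Strict Implicit.
Unset Printing Implicit Defensive.

Import Order.TTheory GRing.Theory VectorInternalTheory.

(** Let m be the number of variables, d = d_max(U), e = d + t, and N = m + e the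
number of vertices.  Letters, positions and vertices are numbered from 0; x_m is the
last variable.

A monomial u is read as the increasing word of its variable indices.  Walk
through the positions a + shift t c, where a is the current index and c the
number of letters already met: a step to the next index leaves a _gap_, a
letter of the word leaves a _mark_.  The m gaps are the complement of the facet
F_t(u), and the deg u marks lie in it.  Conversely the walk can be steered by
any vertex set A, so that there is exactly one word whose marks lie in A and
whose gaps avoid A ([scan], [dominated_anti]); and if the marks of u avoid the
gaps of w, then u is obtained from w by deleting and raising letters
([marks_avoid_gaps]), so that w in U forces u in U.  Hence the intervals
between the marks of u and F_t(u), for u in U, partition the complex, which
gives h_i = #[U]_i ([h_entry_Delta]); and with B_u the product of the variables
at the marks of u, the Stanley-Reisner ideal is generated by the B_u with u not
in U ([nonface_word], [word_nonface]).

The heart of the matter is an exchange ([span_mul_var]).  Suppose that modulo an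
ideal J every variable is a combination of the variables at the gaps of w, and
let X be the variable at the gap of index a.  Then B_w X is either B of the word
w a, or B of a word obtained by lowering a letter of w, times another variable.
By induction B_w times any variable is, modulo J, a combination of B's of words
longer by one letter.  It is used with the gaps of index below q, where q = m or
q = m - 1.

- Let J be the sum of the Stanley-Reisner ideal and of linear forms that span all
  linear forms off these gaps, for the words of U.  Then S/J is spanned in degree j
  by the B_u with u in [U]_j and letters below q ([hilb_upper]).
- For any N - q linear forms, the number of these B_u is a lower bound for the
  dimension of the same piece ([hilb_lower]).  For forms in general position, the exchange
  shows that modulo the forms alone the Stanley-Reisner ideal is spanned by the
  B_w with w not in U ([nonface_span]), while S modulo the forms is a polynomial
  ring in q variables ([dim_piece_setT]).  Any forms are a specialization of
  forms in general position, as K is infinite, and the dimension of the ideal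
  cannot increase under specialization.

Write h_j = #[U]_j, and let c_j count the monomials of [U]_j not divisible by
x_m.  A linear system of parameters theta is independent on every facet, as
otherwise the ideal would vanish on a line ([finite_dim_spans_off]).  So the two
bounds with q = m show that A/theta has Hilbert function h, and the lower bound with
q = m - 1 shows that A/(theta, l) has dimension at least c_j in degree j, with
equality for forms with Vandermonde coefficients.  Thus the weak Lefschetz
property means c_j = max(0, h_j - h_(j-1)) for all j ([hilb_of_lefschetz],
[lefschetz_of_hilb]), which says that in each degree either all of [U]_j is
divisible by x_m ([hilb_last0]) or x_m [U]_(j-1) is contained in [U]_j
([hilb_growth_step]).  The first alternative persists in higher degrees, and
makes h decrease weakly while the second makes it increase weakly; so the change from one to
the other happens at the peak alpha of h ([lefschetz_conditions]).  In the
second condition [U]_(j-1) may be replaced by its shift generators, because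
shift moves commute with the multiplication by x_m ([generators_mul]).

The number of parameters is e because the Krull dimension of A is e: elements
that climb a chain of k primes are algebraically independent modulo the first
one ([chain_independent]), whereas the monomials supported on faces grow too
slowly to leave room for more than e independent elements
([prime_chain_le]). *)

(** * Words, gaps and marks *)

(** How far the l-th letter is moved: by 2 l while letters occupy two vertices each
    (the first t letters), by l + t afterwards. *)
Definition shift (t c : nat) : nat := minn (2 * c) (c + t).

Definition countle (w : seq nat) (a : nat) : nat := count (fun b => b <= a) w.

Definition word (q : nat) (w : seq nat) : bool :=
  sorted leq w && all (fun a => a < q) w.

(** The walk passes the index [a] after having met all letters up to [a]. *)
Definition gap (t : nat) (w : seq nat) (a : nat) : nat := a + shift t (countle w a).

Definition mark (t : nat) (w : seq nat) (l : nat) : nat :=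
  nth 0 w l + shift t l.

Lemma shift0 t : shift t 0 = 0.
Proof. by rewrite /shift; lia. Qed.

Lemma shift_ltn t c c' : c < c' -> shift t c < shift t c'.
Proof. by rewrite /shift; lia. Qed.

Lemma shift_leq t c c' : c <= c' -> shift t c <= shift t c'.
Proof. by rewrite /shift; lia. Qed.

Lemma shift_ltnS t c : shift t c < shift t c.+1.
Proof. exact: shift_ltn. Qed.

Lemma shift_max t c : shift t c <= c + t.
Proof. by rewrite /shift; lia. Qed.

Lemma countle_size w a : countle w a <= size w.
Proof. exact: count_size. Qed.

Lemma countle_leq w a b : a <= b -> countle w a <= countle w b.
Proof. by move=> ab; apply: sub_count => x; move/leq_trans; apply. Qed.

Lemma countle_cons b w a : countle (b :: w) a = (b <= a) + countle w a.
Proof. by []. Qed.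

Lemma countle_path0 b w a : path leq b w -> a < b -> countle w a = 0.
Proof.
move=> /(order_path_min leq_trans)/allP bw ab.
apply/eqP; rewrite -leqn0 leqNgt -has_count; apply/hasPn => y /bw; lia.
Qed.

Lemma ltn_countle w a l : sorted leq w -> l < size w ->
  (l < countle w a) = (nth 0 w l <= a).
Proof.
elim: w l => [//|x w IH] l xw; have sw := path_sorted xw.
rewrite countle_cons; case: l => [_|l lw] /=.
  by case: (leqP x a) => // ax; rewrite (countle_path0 xw).
case: (leqP x a) => [xa|ax]; first by rewrite add1n ltnS IH.
rewrite (countle_path0 xw) //; apply/esym/negbTE; rewrite -ltnNge.
apply: leq_trans ax _; apply: (allP (order_path_min leq_trans xw)).
exact: mem_nth.
Qed.

Lemma countle_eq w a c : sorted leq w -> c <= size w ->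
  (forall l, l < c -> nth 0 w l <= a) ->
  (c < size w -> a < nth 0 w c) -> countle w a = c.
Proof.
move=> sw cw lo hi; apply/eqP; rewrite eqn_leq; apply/andP; split.
  rewrite leqNgt; apply/negP => c_lt.
  have cs := leq_trans c_lt (countle_size w a).
  by move: c_lt; rewrite ltn_countle // leqNgt hi.
case: c cw lo {hi} => [//|c] cw lo; rewrite ltn_countle //; exact: lo.
Qed.

Lemma gap_ltn t w a b : a < b -> gap t w a < gap t w b.
Proof.
move=> ab; rewrite /gap -addSn; apply: leq_add => //.
by apply/shift_leq/countle_leq/ltnW.
Qed.

Lemma gap_inj t w : injective (gap t w).
Proof.
move=> a b; case: (ltngtP a b) => // /(gap_ltn t w); lia.
Qed.

Lemma word_nth q w l : word q w -> l < size w -> nth 0 w l < q.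
Proof. by case/andP=> _ /all_nthP; apply. Qed.

Lemma word_leq_nth q w l k : word q w -> l <= k -> k < size w ->
  nth 0 w l <= nth 0 w k.
Proof.
case/andP=> sw _ lk kw.
by apply: (sorted_leq_nth leq_trans leqnn) => //; rewrite inE //; lia.
Qed.

Lemma mark_ltn t q w l k : word q w -> l < k -> k < size w ->
  mark t w l < mark t w k.
Proof.
move=> ww lk kw; rewrite /mark -addnS leq_add ?shift_ltn //.
by apply: (word_leq_nth ww) => //; apply: ltnW.
Qed.

(** The letter number [l] either is at most [a], and then its mark comes before the
    gap, or it is greater than [a], and then its mark comes after the gap. *)
Lemma mark_notin_gap t q w a l : word q w -> l < size w ->
  mark t w l != gap t w a.
Proof.
move=> /andP[sw _] lw; have := ltn_countle a sw lw; rewrite /mark /gap.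
case: (ltnP l (countle w a)) => [h /esym h'|h /esym/negbT]; last rewrite -ltnNge => h'.
  have := shift_ltn t h; lia.
by have := shift_leq t h; lia.
Qed.

(** The facet as it is written in the definition: one block of consecutive vertices
    per letter, of length two for the first t letters and one for the others, and a
    final segment. *)
Definition in_blocks (m t : nat) (w : seq nat) (v : nat) : bool :=
  has (fun l => (mark t w l <= v) && (v < nth 0 w l + shift t l.+1))
      (iota 0 (size w))
  || (m + shift t (size w) <= v).

(** The blocks and the final segment are what the walk leaves out between its gaps:
    the gap number [a] comes after the blocks of the letters up to [a] and before all
    others. *)
Lemma in_blocksP m t w v : word m w ->
  reflect (forall a, a < m -> gap t w a != v) (in_blocks m t w v).
Proof.
move=> ww; have /andP[sw aw] := ww; apply: (iffP orP) => [+ a am|h].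
  case=> [/hasP[l]|tail]; last first.
    have := shift_leq t (countle_size w a); rewrite /gap; lia.
  rewrite mem_iota /= => lw /andP[lo hi]; move: lo hi; rewrite /gap /mark.
  have := ltn_countle a sw lw.
  case: (ltnP l (countle w a)) => [h /esym h'|h /esym/negbT].
    have := @shift_leq t l.+1 _ h; lia.
  by rewrite -ltnNge; have := shift_leq t h; lia.
case: (leqP (m + shift t (size w)) v) => [|vlt]; [by right|left].
apply/negPn/negP => /hasPn nb.
have nb' l : l < size w -> mark t w l <= v -> nth 0 w l + shift t l.+1 <= v.
  move=> lw lv; have := nb l; rewrite mem_iota /= lv /= -leqNgt; exact.
(* [c] is the number of blocks to the left of v; then v is the gap of index v - shift
   t c. *)
pose P l := (size w <= l) || (v < mark t w l).
have exP : exists l, P l by exists (size w); rewrite /P leqnn.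
have [c Pc cmin] := ex_minnP exP.
have csz : c <= size w by apply: cmin; rewrite /P leqnn.
have lo l : l < c -> nth 0 w l + shift t l.+1 <= v.
  move=> lc; have lw := leq_trans lc csz; apply: nb' => //.
  by rewrite leqNgt; apply/negP => vl; have := cmin l; rewrite /P vl orbT; lia.
have hi : c < size w -> v < mark t w c by move: Pc; rewrite /P; lia.
have cv : shift t c <= v.
  case: (posnP c) => [->|c0]; first by rewrite shift0.
  by have := lo c.-1; rewrite prednK //; lia.
have nl : countle w (v - shift t c) = c.
  apply: countle_eq => // [l lc|cw]; last by have := hi cw; rewrite /mark; lia.
  have lw := leq_trans lc csz.
  have := lo l lc; have : shift t l.+1 <= shift t c by apply: shift_leq.
  have c0 : 0 < c by lia.
  have := lo c.-1; rewrite prednK // => /(_ (leqnn _)).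
  have := @word_leq_nth _ _ l c.-1 ww; lia.
have am : v - shift t c < m.
  case: (ltnP c (size w)) => [cw|szc].
    by have := hi cw; have := word_nth ww cw; rewrite /mark; lia.
  have sc : size w = c by apply: anti_leq; rewrite csz szc.
  by rewrite ltn_subLR // addnC -sc.
by have := h _ am; rewrite /gap nl subnK ?eqxx.
Qed.

Definition dominated (u w : seq nat) : bool :=
  (size u <= size w) && all (fun l => nth 0 w l <= nth 0 u l) (iota 0 (size u)).

Lemma dominatedP u w :
  reflect (size u <= size w /\ forall l, l < size u -> nth 0 w l <= nth 0 u l)
          (dominated u w).
Proof.
apply: (iffP andP) => -[-> h]; split=> //.
  by move=> l lu; apply: (allP h); rewrite mem_iota.
by apply/allP => l; rewrite mem_iota /=; apply: h.
Qed.

(** If the letters of [w] dominate those of [u] before position [l] but not at [l],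
    then exactly [l] letters of [w] are at most the l-th letter a of [u], so the l-th
    mark of [u] is the gap of [w] of index a. *)
Lemma marks_avoid_gaps m t u w : word m u -> word m w ->
  (forall l a, l < size u -> a < m -> mark t u l != gap t w a) ->
  dominated u w.
Proof.
move=> wu ww av.
have key l : l < size u -> l < size w /\ nth 0 w l <= nth 0 u l.
  elim/ltn_ind: l => l IH lu.
  have [/andP//|bad] := boolP ((l < size w) && (nth 0 w l <= nth 0 u l)).
  have lw : l <= size w.
    case: (posnP l) => [->//|l0].
    by have := IH l.-1; rewrite prednK //; case=> //; lia.
  have nl : countle w (nth 0 u l) = l.
    apply: countle_eq => //; [by case/andP: ww|move=> k kl|lia].
    have [_ h] := IH k kl (ltn_trans kl lu).
    by apply: leq_trans h _; apply: (word_leq_nth wu) => //; lia.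
  by have := av l _ lu (word_nth wu lu); rewrite /mark /gap nl eqxx.
apply/dominatedP; split=> [|l /key[]//].
by case: (posnP (size u)) => [->//|u0]; have := key (size u).-1; lia.
Qed.

Lemma dominated_anti u w : dominated u w -> dominated w u -> u = w.
Proof.
move=> /dominatedP[s1 h1] /dominatedP[s2 h2].
apply: (@eq_from_nth _ 0) => [|l lu]; first lia.
by apply/eqP; rewrite eqn_leq h1 // h2 //; lia.
Qed.

(** The walk is steered by [A]: at each position it takes a letter if the position is
    in [A] and proceeds to the next index otherwise. *)
Lemma scan m t N (A : pred nat) : (forall v, A v -> v < N) ->
  exists w, [/\ word m w, forall l, l < size w -> A (mark t w l)
    & forall a, a < m -> ~~ A (gap t w a)].
Proof.
move=> AN.
(* From index [a], with [c] letters behind it; [k] bounds the number of positions left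
   before the walk leaves A for good. *)
have main : forall k a c, N <= a + shift t c + k ->
    exists w, [/\ path leq a w, all (fun b => b < m) w,
      forall l, l < size w -> A (nth 0 w l + shift t (c + l))
      & forall b, a <= b < m -> ~~ A (b + shift t (c + countle w b))]; last first.
  have [|w [sw bw Aw nAw]] := main N 0 0; first by rewrite leq_addl.
  exists w; split=> [|//|a am]; last exact: nAw.
  by rewrite /word (path_sorted sw).
elim=> [|k IH] a c Nk.
  exists [::]; split=> // b /andP[ab _]; apply/negP => /AN.
  by rewrite /countle /= !addn0 in Nk *; lia.
case: (leqP m a) => [ma|am].
  by exists [::]; split=> // b; lia.
case: (boolP (A (a + shift t c))) => Aa.
  have [|w [sw bw Aw nAw]] := IH a c.+1.
    by have := shift_ltnS t c; lia.
  exists (a :: w); rewrite /= leqnn am; split=> //.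
    by case=> [|l] lw /=; rewrite ?addn0 // addnS -addSn Aw.
  move=> b ab; rewrite /countle /=; have -> : a <= b by lia.
  by rewrite addnA addn1; apply: nAw.
have [|w [sw bw Aw nAw]] := IH a.+1 c; first lia.
exists w; split=> //.
  by case: w sw {bw Aw nAw IH}  => //= x w /andP[ax ->]; rewrite andbT; exact: ltnW.
move=> b /andP[]; rewrite leq_eqVlt => /predU1P[<- _|ab bm]; last first.
  by apply: nAw; rewrite ab.
by rewrite (countle_path0 sw) ?addn0.
Qed.

(** * Monomials as words *)

Definition word_of m (u : 'X_{1..m}) : seq nat := [seq val i | i <- m2s u].

Definition mon m (w : seq nat) : 'X_{1..m} :=
  [multinom count_mem (val i) w | i < m].

Lemma word_of_word m (u : 'X_{1..m}) : word m (word_of u).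
Proof.
by rewrite /word srt_m2s; apply/allP => _ /mapP[i _ ->]; apply: ltn_ord.
Qed.

Lemma size_word_of m (u : 'X_{1..m}) : size (word_of u) = mdeg u.
Proof. by rewrite size_map size_m2s. Qed.

Lemma mem_word_of m (u : 'X_{1..m}) (i : 'I_m) : (val i \in word_of u) = (u i != 0).
Proof.
rewrite (mem_map val_inj) -has_pred1 has_count -lt0n.
by have /mnmP/(_ i) := s2mK u; rewrite mnmE => ->.
Qed.

Lemma word_ofK m : cancel (@word_of m) (@mon m).
Proof.
move=> u; rewrite -[RHS]s2mK; apply/mnmP => i; rewrite !mnmE count_map.
by apply: eq_count => j /=; rewrite (inj_eq val_inj).
Qed.

Lemma monK m w : word m w -> word_of (mon m w) = w.
Proof.
move=> ww; have /andP[sw aw] := ww.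
have /andP[su _] := word_of_word (mon m w).
apply: (sorted_eq leq_trans anti_leq su sw).
apply/allP => a; rewrite mem_cat /= => aP.
have am : a < m.
  have /andP[_ /allP aU] := word_of_word (mon m w).
  by case/orP: aP => [/aU|/(allP aw)].
have /mnmP/(_ (Ordinal am)) := word_ofK (mon m w).
by rewrite !mnmE /= => ->.
Qed.

Lemma word_of_inj m : injective (@word_of m).
Proof. exact: can_inj (@word_ofK m). Qed.

Lemma mon_inj m q w w' : q <= m -> word q w -> word q w' -> mon m w = mon m w' -> w = w'.
Proof.
have ext v : q <= m -> word q v -> word m v.
  move=> qm /andP[sv /allP av]; rewrite /word sv; apply/allP => a /av; lia.
by move=> qm /(ext _ qm)/monK {2}<- /(ext _ qm)/monK {2}<- ->.
Qed.

Lemma wordW q m w : q <= m -> word q w -> word m w.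
Proof.
move=> qm /andP[sv /allP av]; rewrite /word sv; apply/allP => a /av; lia.
Qed.

Lemma mdeg_mon m w : word m w -> mdeg (mon m w) = size w.
Proof. by move/monK => {2}<-; rewrite size_word_of. Qed.

Lemma mon_cons m (i : 'I_m) w : mon m (val i :: w) = (U_(i) + mon m w)%MM.
Proof. by apply/mnmP => j; rewrite mnmDE !mnmE. Qed.

Lemma mon_perm m w w' : perm_eq w w' -> mon m w = mon m w'.
Proof. by move/permP => e; apply/mnmP => i; rewrite !mnmE e. Qed.

Lemma mon_cat m w w' : mon m (w ++ w') = (mon m w + mon m w')%MM.
Proof. by apply/mnmP => i; rewrite mnmDE !mnmE count_cat. Qed.

Lemma mdegS_var m (u : 'X_{1..m}) k : mdeg u = k.+1 ->
  exists2 i : 'I_m, (U_(i) <= u)%MM & mdeg (u - U_(i)) = k.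
Proof.
move=> uk; have [i ui] : exists i, u i != 0.
  apply/existsP; apply: contraPT uk => /existsPn u0.
  by rewrite mdegE big1 // => i _; apply/eqP/negPn/u0.
have iu : (U_(i) <= u)%MM by rewrite lep1mP.
exists i => //.
by move: uk; rewrite -{1}(submK iu) mdegD mdeg1 addn1 => -[].
Qed.

Section Ideal.
Variables (m : nat) (U : {fset 'X_{1..m}}).
Hypotheses (U_ideal : order_ideal U) (U_shifted : shifted U).

(** The letters are raised one at a time, and the prefix [p] collects those already
    raised; it is not sorted in general, which does no harm as [mon] ignores the
    order. *)
Lemma shift_entries p x y : all (fun a => a < m) (p ++ y) -> size x = size y ->
  (forall l, l < size x -> nth 0 x l <= nth 0 y l) ->
  mon m (p ++ x) \in U -> mon m (p ++ y) \in U.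
Proof.
elim: x y p => [|a x IH] [|b y] p //= ally [sxy] le_xy pxU.
rewrite -cat_rcons; apply: IH => // [|l lx|]; first by rewrite cat_rcons.
  exact: (le_xy l.+1).
have bm : b < m by move: ally; rewrite all_cat /= => /and3P[].
have := le_xy 0 isT; rewrite /= leq_eqVlt => /predU1P[<-|ab].
  by rewrite cat_rcons.
have am := ltn_trans ab bm.
have E (c : nat) (cm : c < m) :
    mon m (rcons p c ++ x) = (U_(Ordinal cm) + mon m (p ++ x))%MM.
  rewrite -mon_cons; apply: mon_perm.
  by rewrite cat_rcons -[c :: x]cat1s perm_catCA cat1s.
rewrite (E b bm); apply: (U_shifted (i := Ordinal am)) => //=.
by rewrite -E cat_rcons.
Qed.

(** Cutting [w] to the length of [u] divides the monomial, and then each letter is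
    raised by shifting. *)
Lemma dominated_in u w : word m u -> word m w -> dominated u w ->
  mon m w \in U -> mon m u \in U.
Proof.
move=> /andP[_ au] ww /dominatedP[suw le_wu] wU.
have pU : mon m (take (size u) w) \in U.
  case: U_ideal => Ucl _ _; apply: Ucl wU _.
  rewrite -{2}(cat_take_drop (size u) w) mon_cat; exact: lem_addr.
apply: (@shift_entries [::] (take (size u) w)) => //.
  by rewrite size_takel.
move=> l; rewrite size_takel // => lu; rewrite nth_take //; exact: le_wu.
Qed.

Lemma mdeg_dmax u : u \in U -> mdeg u <= dmax U.
Proof. by move=> uU; rewrite /dmax; apply: (leq_bigmax_seq (F := @mdeg m)). Qed.

End Ideal.

Lemma var_indicesE m (u : 'X_{1..m}) : var_indices u = [seq a.+1 | a <- word_of u].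
Proof.
rewrite /var_indices /word_of /m2s -map_comp map_flatten -[in RHS]map_comp.
by congr flatten; apply: eq_map => i /=; rewrite map_nseq.
Qed.

Lemma mem_facet_seq m t d w v : v < m + t + d -> size w <= d ->
  (v.+1 \in facet_seq m t d [seq a.+1 | a <- w]) = in_blocks m t w v.
Proof.
move=> vN wd; rewrite /facet_seq /in_blocks size_map.
have nthS l : 0 < l <= size w -> nth 0 [seq a.+1 | a <- w] l.-1 = (nth 0 w l.-1).+1.
  by case: l => // l lw; rewrite (nth_map 0).
case: ltnP => [tw|wt]; last first.
- rewrite mem_cat mem_index_iota; congr (_ || _); last by rewrite /shift; lia.
  apply/flatten_mapP/hasP => [[l]|[l]].
    rewrite mem_index_iota !inE => lw; have lw' : 0 < l <= size w by lia.
    rewrite nthS // => h; exists l.-1; first by rewrite mem_iota; lia.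
    by rewrite /mark /shift; lia.
  rewrite mem_iota /mark /shift => lw h; exists l.+1; first by rewrite mem_index_iota; lia.
  by rewrite nthS ?inE /=; lia.
- rewrite !mem_cat mem_index_iota orbA; congr (_ || _); last by rewrite /shift; lia.
  apply/orP/hasP => [[/flatten_mapP[l]|/mapP[l]]|[l]].
  + rewrite mem_index_iota !inE => lw; have lw' : 0 < l <= size w by lia.
    rewrite nthS // => h; exists l.-1; first by rewrite mem_iota; lia.
    by rewrite /mark /shift; lia.
  + rewrite mem_index_iota => lw; have lw' : 0 < l <= size w by lia.
    rewrite nthS // => h; exists l.-1; first by rewrite mem_iota; lia.
    by rewrite /mark /shift; lia.
  rewrite mem_iota /mark /shift => lw h; case: (ltnP l t) => lt; [left|right].
    apply/flatten_mapP; exists l.+1; first by rewrite mem_index_iota; lia.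
    by rewrite nthS ?inE /=; lia.
  apply/mapP; exists l.+1; first by rewrite mem_index_iota; lia.
  by rewrite nthS /=; lia.
Qed.

Lemma in_facet m t d (u : 'X_{1..m}) (v : 'I_(m + t + d)) : mdeg u <= d ->
  reflect (forall a, a < m -> gap t (word_of u) a != v) (v \in facet t d u).
Proof.
move=> ud; rewrite inE var_indicesE mem_facet_seq ?size_word_of //.
exact: in_blocksP (word_of_word u).
Qed.

(** * The partition of a squeezed complex and its h-vector *)

Definition gaps t N (q : nat) (w : seq nat) : {set 'I_N} :=
  [set v : 'I_N | [exists a : 'I_q, gap t w a == v]].

Definition marks t N (w : seq nat) : {set 'I_N} :=
  [set v : 'I_N | [exists l : 'I_(size w), mark t w l == v]].

Lemma in_gaps t N q w (v : 'I_N) :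
  reflect (exists2 a, a < q & gap t w a = v) (v \in gaps t N q w).
Proof.
rewrite inE; apply: (iffP existsP) => [[a /eqP <-]|[a aq <-]]; first by exists a.
by exists (Ordinal aq) => /=.
Qed.

Lemma in_marks t N w (v : 'I_N) :
  reflect (exists2 l, l < size w & mark t w l = v) (v \in marks t N w).
Proof.
rewrite inE; apply: (iffP existsP) => [[a /eqP <-]|[a aq <-]]; first by exists a.
by exists (Ordinal aq) => /=.
Qed.

Lemma card_image_nat N k (f : nat -> nat) (A : {set 'I_N}) :
  {in gtn k &, injective f} -> (forall a, a < k -> f a < N) ->
  A = [set v : 'I_N | [exists a : 'I_k, f a == v]] -> #|A| = k.
Proof.
move=> fI fN ->; pose g (a : 'I_k) : 'I_N := Ordinal (fN a (ltn_ord a)).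
have gI : injective g.
  by move=> a b /(congr1 val) /= /fI ab; apply: val_inj; apply: ab; rewrite inE.
rewrite -[RHS]card_ord -(card_imset _ gI); apply: eq_card => v; rewrite inE.
apply/existsP/imsetP => [[a /eqP fa]|[a _ ->]]; last by exists a.
by exists a => //; apply: val_inj.
Qed.

Lemma card_initial N q : q <= N -> #|[set v : 'I_N | v < q]| = q.
Proof.
move=> qN; apply: (card_image_nat (f := id)) => [a b //|a aq|]; first lia.
apply/setP => v; rewrite !inE; apply/idP/existsP => [vq|[a /eqP <-]//].
by exists (Ordinal vq).
Qed.

Lemma card_gaps t N q w : q + shift t (size w) <= N -> #|gaps t N q w| = q.
Proof.
move=> qN; apply: (card_image_nat _ _ (erefl _)) => [a b _ _|a aq].
  exact: gap_inj.
by have := shift_leq t (countle_size w a); rewrite /gap; lia.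
Qed.

Lemma card_marks t N q w : word q w -> q + shift t (size w) <= N ->
  #|marks t N w| = size w.
Proof.
move=> ww qN; apply: (card_image_nat _ _ (erefl _)) => [a b|a aq].
  rewrite !inE => aw bw; case: (ltngtP a b) => // ab.
    by have := mark_ltn t ww ab bw; lia.
  by have := mark_ltn t ww ab aw; lia.
have := word_nth ww aq; have := @shift_leq t a (size w) (ltnW aq).
by rewrite /mark; lia.
Qed.

Lemma marks_sub_gapsC t N q w : word q w -> marks t N w \subset ~: gaps t N q w.
Proof.
move=> ww; apply/subsetP => v /in_marks[l lw e].
rewrite inE; apply/in_gaps => -[a _]; rewrite -e => /esym/eqP.
by rewrite (negbTE (mark_notin_gap t a ww lw)).
Qed.

Local Open Scope ring_scope.

(** Binomial expansion of (y + 1) to the size of F minus M, by splitting off one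
    element. *)
Lemma sum_interval (R : comNzRingType) (T : finType) (M F : {set T}) (y : R) :
  M \subset F ->
  \sum_(A : {set T} | (M \subset A) && (A \subset F)) y ^+ (#|F| - #|A|)
    = (y + 1) ^+ (#|F| - #|M|).
Proof.
move: {2}(#|F :\: M|) (erefl #|F :\: M|) => k.
elim: k M F => [|k IH] M F FM MF.
  have {FM} FM : F = M.
    apply/eqP; rewrite eqEsubset MF andbT -setD_eq0 -cards_eq0; exact/eqP.
  rewrite FM subnn expr0 (big_pred1 M) ?subnn ?expr0 // => A.
  by rewrite /= eqEsubset andbC.
have /card_gt0P[x] : (0 < #|F :\: M|)%N by rewrite FM.
rewrite inE => /andP[xM xF].
have cF : #|F| = #|F :\ x|.+1 by rewrite (cardsD1 x F) xF.
have cM : #|x |: M| = #|M|.+1 by rewrite cardsU1 xM.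
have sM : x |: M \subset F by rewrite subUset sub1set xF.
have sF : M \subset F :\ x by rewrite subsetD1 MF.
have lM : (#|M| < #|F|)%N by have := subset_leq_card sM; rewrite cM.
rewrite (bigID (fun A : {set T} => x \in A)) /=.
rewrite (eq_bigl (fun A : {set T} => (x |: M \subset A) && (A \subset F))).
  rewrite IH //; last by move: FM; rewrite !cardsDS // cM; lia.
  rewrite cM (eq_bigl (fun A : {set T} => (M \subset A) && (A \subset F :\ x))); last first.
    by move=> A; rewrite subsetD1 andbA.
  rewrite (eq_bigr (fun A : {set T} => y * y ^+ (#|F :\ x| - #|A|))); last first.
    move=> A /andP[_ /subset_leq_card AF]; rewrite -exprS; congr (_ ^+ _).
    by rewrite cF subSn.
  rewrite -big_distrr /= IH //; last by move: FM; rewrite (cardsDS MF) (cardsDS sF) cF; lia.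
  rewrite cF subSS subSn; last by rewrite -ltnS -cF.
  by rewrite exprS mulrDl mul1r addrC.
by move=> A; rewrite subUset sub1set; case: (x \in A); rewrite /= ?andbF ?andbT.
Qed.

Section Squeezed.
Variables (m : nat) (U : {fset 'X_{1..m}}) (t N : nat) (Delta : {set {set 'I_N}}).
Hypotheses (U_ideal : order_ideal U) (U_shifted : shifted U).
Hypothesis N_def : N = (m + t + dmax U)%N.
Hypothesis Delta_def :
  Delta = [set A : {set 'I_N} | [exists u : U, A \subset ~: gaps t N m (word_of (val u))]].

Lemma DeltaP (A : {set 'I_N}) :
  reflect (exists2 u, u \in U & A \subset ~: gaps t N m (word_of u)) (A \in Delta).
Proof.
rewrite Delta_def inE; apply: (iffP existsP) => [[u uA]|[u uU uA]].
  by exists (val u) => //; apply: valP.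
by exists [` uU]%fset.
Qed.

Lemma size_word_dmax u : u \in U -> (m + shift t (size (word_of u)) <= N)%N.
Proof.
move=> /mdeg_dmax; rewrite size_word_of N_def => ud.
rewrite -addnA leq_add2l (leq_trans (shift_leq t ud)) //.
by rewrite addnC shift_max.
Qed.

Lemma marks_in_U u w : word m w -> u \in U ->
  (forall l, (l < size w)%N -> (mark t w l < N)%N) ->
  marks t N w \subset ~: gaps t N m (word_of u) -> mon m w \in U.
Proof.
move=> ww uU wN /subsetP sub.
have dom : dominated w (word_of u).
  apply: (marks_avoid_gaps (t := t) ww (word_of_word u)) => l a lw am.
  have /sub : Ordinal (wN l lw) \in marks t N w by apply/in_marks; exists l.
  rewrite inE; apply: contra => /eqP e; apply/in_gaps; by exists a.
by apply: (dominated_in U_ideal U_shifted ww (word_of_word u) dom); rewrite word_ofK.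
Qed.

(** [scan] for sets of vertices, whether faces or not. *)
Lemma scan_set (A : {set 'I_N}) : exists w, [/\ word m w,
  forall l, (l < size w)%N -> (mark t w l < N)%N, marks t N w \subset A
  & A \subset ~: gaps t N m w].
Proof.
pose P v := [exists x : 'I_N, (x \in A) && (val x == v)].
have PN v : P v -> (v < N)%N by case/existsP => x /andP[_ /eqP <-]; apply: ltn_ord.
have [w [ww mw gw]] := scan m t PN.
exists w; split=> // [l /mw/PN //||].
  apply/subsetP => v /in_marks[l lw e].
  have /existsP[x /andP[xA /eqP xe]] := mw l lw.
  by have -> : v = x by apply: val_inj; rewrite xe e.
apply/subsetP => v vA; rewrite inE; apply/in_gaps => -[a am e].
by have /negP := gw a am; apply; apply/existsP; exists v; rewrite vA e eqxx.
Qed.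

(** So the Stanley-Reisner ideal is generated by the products over marks of words
    outside U. *)
Lemma nonface_word A : A \notin Delta -> exists w, [/\ word m w, mon m w \notin U,
   marks t N w \subset A & forall l, (l < size w)%N -> (mark t w l < N)%N].
Proof.
move=> AD; have [w [ww wN mw gw]] := scan_set A; exists w; split=> //.
by apply: contra AD => wU; apply/DeltaP; exists (mon m w); rewrite ?monK.
Qed.

Lemma word_nonface w : word m w -> mon m w \notin U ->
  (forall l, (l < size w)%N -> (mark t w l < N)%N) -> marks t N w \notin Delta.
Proof.
move=> ww wU wN; apply: contra wU => /DeltaP[u uU]; exact: marks_in_U.
Qed.

Lemma Delta_sub (A B : {set 'I_N}) : A \subset B -> B \in Delta -> A \in Delta.
Proof.
by move=> AB /DeltaP[u uU Bu]; apply/DeltaP; exists u => //; apply: subset_trans Bu.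
Qed.

Lemma mark_lt_N u l : u \in U -> (l < size (word_of u))%N ->
  (mark t (word_of u) l < N)%N.
Proof.
move=> uU lw; have := word_nth (word_of_word u) lw.
have := size_word_dmax uU; have := @shift_leq t l _ (ltnW lw).
by rewrite /mark; lia.
Qed.

Definition face_interval (u : 'X_{1..m}) (A : {set 'I_N}) :=
  (marks t N (word_of u) \subset A) && (A \subset ~: gaps t N m (word_of u)).

(** Marks of either word avoid the gaps of the other, so that each dominates the
    other. *)
Lemma face_interval_uniq u v A : u \in U -> v \in U ->
  face_interval u A -> face_interval v A -> u = v.
Proof.
have half a b : a \in U -> b \in U -> face_interval a A -> face_interval b A ->
    dominated (word_of a) (word_of b).
  move=> aU bU /andP[ma _] /andP[_ gb].
  apply: (marks_avoid_gaps (t := t) (word_of_word a) (word_of_word b)) => l i lw im.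
  have /(subsetP (subset_trans ma gb)) : Ordinal (mark_lt_N aU lw) \in marks t N (word_of a).
    by apply/in_marks; exists l.
  rewrite inE; apply: contra => /eqP e; apply/in_gaps; by exists i.
move=> uU vU iu iv; apply: word_of_inj.
by apply: dominated_anti; apply: half.
Qed.

Lemma face_interval_ex A : A \in Delta -> exists2 u, u \in U & face_interval u A.
Proof.
have [w [ww wN mw gw]] := scan_set A.
case/DeltaP => u uU Au; exists (mon m w); last by rewrite /face_interval monK ?mw.
by apply: (marks_in_U ww uU wN); apply: subset_trans Au.
Qed.

(** Each interval between marks and facet contributes one power of z, by the binomial
    theorem. *)
Lemma h_poly_Delta :
  h_poly Delta (dmax U + t) = \sum_(u <- U) 'X ^+ (dmax U + t - mdeg u).
Proof.
set e := (dmax U + t)%N; rewrite big_seq_fsetE /=.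
have cardF u : u \in U -> #|~: gaps t N m (word_of u)| = e.
  move=> uU; rewrite cardsCs setCK card_ord card_gaps ?N_def /e; first lia.
  by rewrite -N_def size_word_dmax.
have cardD A : A \in Delta -> (#|A| < e.+1)%N.
  by case/DeltaP => u uU /subset_leq_card; rewrite cardF.
(* The sum over sizes becomes a sum over faces, then over the intervals. *)
transitivity (\sum_(A in Delta) ('X - 1 : {poly int}) ^+ (e - #|A|)).
  rewrite /h_poly.
  transitivity (\sum_(i < e.+1) \sum_(A in Delta | #|A| == i)
                  ('X - 1 : {poly int}) ^+ (e - #|A|)).
    apply: eq_bigr => i _.
    rewrite (eq_bigr (fun=> ('X - 1 : {poly int}) ^+ (e - i))); last first.
      by move=> A /andP[_ /eqP ->].
    rewrite /card_faces sumr_const scaler_nat; congr (_ *+ _).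
    by apply: eq_card => A; rewrite !inE.
  rewrite (exchange_big_dep (mem Delta)) /=; last by move=> i A _ /andP[].
  apply: eq_bigr => A AD; rewrite (big_pred1 (Ordinal (cardD A AD))) // => i.
  by rewrite AD /= eq_sym.
transitivity (\sum_(A in Delta) \sum_(u : U | face_interval (val u) A)
                  ('X - 1 : {poly int}) ^+ (e - #|A|)).
  apply: eq_bigr => A AD; have [u uU uA] := face_interval_ex AD.
  rewrite (big_pred1 [` uU]%fset) // => v /=; apply/idP/eqP => [vA|->//].
  by apply: val_inj; apply: (face_interval_uniq (valP v) uU vA uA).
rewrite (exchange_big_dep predT) //=; apply: eq_bigr => u _.
have uU : val u \in U := valP u.
transitivity (\sum_(A | face_interval (val u) A) ('X - 1 : {poly int}) ^+ (e - #|A|)).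
  apply: eq_bigl => A; apply/andP/idP => [[]//|uA]; split=> //.
  by apply/DeltaP; exists (val u) => //; case/andP: uA.
have := @sum_interval {poly int} _ _ _ ('X - 1)
  (marks_sub_gapsC t N (word_of_word (val u))).
rewrite subrK cardF // (card_marks (word_of_word _) (size_word_dmax uU)).
by rewrite size_word_of.
Qed.

Lemma h_entry_Delta i : (i <= dmax U)%N ->
  h_entry Delta (dmax U + t) i = (count (fun u => mdeg u == i) U)%:Z.
Proof.
move=> id; rewrite /h_entry h_poly_Delta coef_sum -sum1_count.
rewrite -natz natr_sum [RHS]big_mkcond /= !big_seq; apply: eq_bigr => u /mdeg_dmax ud.
rewrite coefXn; have -> : (dmax U + t - i == dmax U + t - mdeg u)%N = (mdeg u == i) by lia.
by case: ifP.
Qed.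

End Squeezed.

Lemma squeezed_complexE m (U : {fset 'X_{1..m}}) t :
  squeezed_complex U t = [set A : {set 'I_(m + t + dmax U)} |
    [exists u : U, A \subset ~: gaps t _ m (word_of (val u))]].
Proof.
apply/setP => A; rewrite !inE; apply: eq_existsb => u.
suff -> : facet t (dmax U) (val u) = ~: gaps t _ m (word_of (val u)) by [].
have ud := mdeg_dmax (valP u).
apply/setP => v; rewrite [RHS]inE.
apply/idP/idP => [/(in_facet v ud) h|/in_gaps h].
  apply/in_gaps => -[a am e].
  by have := h a am; rewrite e eqxx.
by apply/(in_facet v ud) => a am; apply/eqP => e; apply: h; exists a.
Qed.

(** * The exchange lemma *)

Section Ideals.
Variables (R : comNzRingType).
Implicit Types J : R -> Prop.

Definition is_ideal J : Prop :=
  [/\ J 0, forall f g, J f -> J g -> J (f + g) & forall f g, J g -> J (f * g)].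

Lemma ideal0 J : is_ideal J -> J 0. Proof. by case. Qed.
Lemma idealD J f g : is_ideal J -> J f -> J g -> J (f + g).
Proof. by case=> _ + _; apply. Qed.
Lemma idealM J f g : is_ideal J -> J g -> J (f * g).
Proof. by case=> _ _; apply. Qed.
Lemma ideal_sum J (T : eqType) (s : seq T) (F : T -> R) : is_ideal J ->
  (forall x, x \in s -> J (F x)) -> J (\sum_(x <- s) F x).
Proof.
move=> iJ JF; rewrite big_seq; elim/big_ind: _ => //; first exact: ideal0.
by move=> f g; apply: idealD.
Qed.

End Ideals.

Section IdealGen.
Variables (K : fieldType) (N : nat).
Local Notation S := {mpoly K[N]}.

Lemma ideal_gen_ideal (G : S -> Prop) : is_ideal (ideal_gen G).
Proof.
split; first by exists [::]; rewrite big_nil.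
  move=> f g [s [Gs ->]] [s' [Gs' ->]]; exists (s ++ s'); rewrite big_cat.
  by split=> // p; rewrite mem_cat => /orP[/Gs|/Gs'].
move=> f g [s [Gs ->]]; exists [seq (f * p.1, p.2) | p <- s]; split.
  by move=> _ /mapP[p /Gs ? ->].
by rewrite big_map mulr_sumr; apply: eq_bigr => p _ /=; rewrite mulrA.
Qed.

Lemma ideal_gen_mem (G : S -> Prop) f : G f -> ideal_gen G f.
Proof.
move=> Gf; exists [:: (1, f)]; rewrite big_seq1 mul1r; split=> // p.
by rewrite inE => /eqP ->.
Qed.

Lemma ideal_gen_sub (G J : S -> Prop) : is_ideal J ->
  (forall f, G f -> J f) -> forall f, ideal_gen G f -> J f.
Proof.
move=> iJ GJ f [s [Gs ->]]; apply: ideal_sum => // p ps.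
by apply: idealM => //; apply/GJ/Gs.
Qed.

End IdealGen.

Section Span.
Variables (K : fieldType) (N t : nat).
Local Notation S := {mpoly K[N]}.
Implicit Types (J : S -> Prop) (P Q : seq nat -> Prop) (w : seq nat).

(** Words may be too long for their marks to be vertices; the product over such marks
    is to be 0, as for nonfaces. *)
Definition yvar (k : nat) : S := if insub k is Some v then 'X_v else 0.

Lemma yvar_ord (v : 'I_N) : yvar v = 'X_v.
Proof. by rewrite /yvar valK. Qed.

Lemma yvarP k : yvar k = 0 \/ exists2 v : 'I_N, val v = k & yvar k = 'X_v.
Proof.
by rewrite /yvar; case: insubP => [v _ vk|]; [right; exists v|left].
Qed.

Definition mark_prod w : S := \prod_(l < size w) yvar (mark t w l).

Definition in_span J P (f : S) : Prop :=
  exists s : seq (K * seq nat), (forall x, x \in s -> P x.2) /\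
    J (f - \sum_(x <- s) x.1 *: mark_prod x.2).

Section Closure.
Variables (J : S -> Prop) (P : seq nat -> Prop).
Hypothesis iJ : is_ideal J.

Lemma in_span_ideal f : J f -> in_span J P f.
Proof. by move=> Jf; exists [::]; rewrite big_nil subr0. Qed.

Lemma in_spanD f g : in_span J P f -> in_span J P g -> in_span J P (f + g).
Proof.
move=> [s [Ps Js]] [s' [Ps' Js']]; exists (s ++ s'); split.
  by move=> x; rewrite mem_cat => /orP[/Ps|/Ps'].
by rewrite big_cat /= opprD addrACA; apply: idealD.
Qed.

Lemma in_spanZ c f : in_span J P f -> in_span J P (c *: f).
Proof.
move=> [s [Ps Js]]; exists [seq (c * x.1, x.2) | x <- s]; split.
  by move=> _ /mapP[x /Ps ? ->].
rewrite big_map (eq_bigr (fun x => c *: (x.1 *: mark_prod x.2))); last first.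
  by move=> x _; rewrite scalerA.
by rewrite -scaler_sumr -scalerBr -mul_mpolyC; apply: idealM.
Qed.

Lemma in_span_sum (T : eqType) (s : seq T) (F : T -> S) :
  (forall x, x \in s -> in_span J P (F x)) -> in_span J P (\sum_(x <- s) F x).
Proof.
move=> JF; rewrite big_seq; elim/big_ind: _ => //; last exact: in_spanD.
by apply: in_span_ideal; apply: ideal0.
Qed.

Lemma in_span_mark_prod w : P w -> in_span J P (mark_prod w).
Proof.
move=> Pw; exists [:: (1, w)]; rewrite big_seq1 scale1r subrr; split.
  by move=> x; rewrite inE => /eqP ->.
exact: ideal0.
Qed.

Lemma in_span_mod f g : J (f - g) -> in_span J P g -> in_span J P f.
Proof.
by move=> Jfg /(in_spanD (in_span_ideal Jfg)); rewrite subrK.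
Qed.

End Closure.

Lemma in_spanM J P Q f g : is_ideal J -> in_span J P f ->
  (forall w, P w -> in_span J Q (mark_prod w * g)) -> in_span J Q (f * g).
Proof.
move=> iJ [s [Ps Js]] PQ.
apply: (@in_span_mod _ _ iJ _ ((\sum_(x <- s) x.1 *: mark_prod x.2) * g)).
  by rewrite -mulrBl mulrC; apply: idealM.
rewrite mulr_suml; apply: in_span_sum => // x /Ps Px.
by rewrite -scalerAl; apply/in_spanZ/PQ.
Qed.

Lemma mark_prod_rcons w a :
  mark_prod (rcons w a) = mark_prod w * yvar (a + shift t (size w)).
Proof.
rewrite /mark_prod size_rcons big_ord_recr /=; congr (_ * yvar _).
  by apply: eq_bigr => l _; rewrite /mark nth_rcons ltn_ord.
by rewrite /mark nth_rcons ltnn eqxx.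
Qed.

Lemma size_set_entry w c a : (c < size w)%N -> size (set_nth 0%N w c a) = size w.
Proof. by move=> cw; rewrite size_set_nth; apply/maxn_idPr. Qed.

(** Lowering the letter number [c] moves its mark to the position where the walk would
    have passed the index [a]. *)
Lemma mark_prod_set w c a : (c < size w)%N ->
  mark_prod (set_nth 0%N w c a) * yvar (mark t w c)
  = mark_prod w * yvar (a + shift t c).
Proof.
move=> cw; rewrite /mark_prod size_set_entry //.
rewrite (bigD1 (Ordinal cw)) //= [in RHS](bigD1 (Ordinal cw)) //=.
rewrite mulrAC [RHS]mulrAC [X in X * _]mulrC; congr (_ * yvar _ * _).
  by rewrite /mark nth_set_nth /= eqxx.
apply: eq_bigr => l lc; rewrite /mark nth_set_nth /=.
by rewrite -val_eqE /= in lc; rewrite (negbTE lc).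
Qed.

Lemma word_set q w a : word q w -> (a < q)%N -> (countle w a < size w)%N ->
  word q (set_nth 0%N w (countle w a) a) /\ (a < nth 0%N w (countle w a))%N.
Proof.
move=> ww aq cw; set c := countle w a; have /andP[sw aw] := ww.
have ac : (a < nth 0%N w c)%N by rewrite ltnNge -ltn_countle // ltnn.
split=> //; rewrite /word; apply/andP; split; last first.
  apply/(all_nthP 0%N) => l; rewrite size_set_entry // => lw.
  by rewrite nth_set_nth /=; case: eqP => // _; apply: word_nth ww lw.
apply/(sortedP 0%N) => l; rewrite size_set_entry // => lw.
rewrite !nth_set_nth /=; case: eqP => [lc|_]; case: eqP => [lc'|lc'].
- by lia.
- rewrite -lc in ac *; apply: leq_trans (ltnW ac) _.
  by apply: (word_leq_nth ww).
- by rewrite -ltn_countle // ?lc' //; lia.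
- by apply: (word_leq_nth ww).
Qed.

Lemma word_rcons q w a : word q w -> (a < q)%N -> countle w a = size w ->
  word q (rcons w a).
Proof.
move=> /andP[sw aw] aq na; rewrite /word all_rcons aq aw !andbT /=.
case: w sw na {aw} => //= x w sw na; rewrite rcons_path sw /=.
rewrite (last_nth 0%N) -ltn_countle /= ?na //.
Qed.

Definition gap_spans J q w : Prop :=
  forall v : 'I_N, exists x : 'I_N -> K,
    J ('X_v - \sum_v' x v' *: 'X_v') /\
    forall v', x v' != 0 -> v' \in gaps t N q w.

Section Multiply.
Variables (J : S -> Prop) (P : seq nat -> Prop) (q j : nat).
Hypothesis iJ : is_ideal J.
Hypothesis P_lower : forall w a, word q w -> P w -> size w = j -> (a < q)%N ->
  (countle w a < j)%N -> P (set_nth 0%N w (countle w a) a).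
Hypothesis P_extend : forall w a, word q w -> P w -> size w = j -> (a < q)%N ->
  countle w a = j -> P (rcons w a).
Hypothesis P_good : forall w, word q w -> P w -> size w = j ->
  J (mark_prod w) \/ gap_spans J q w.

(** The exchange lemma. Write the variable as a combination of gap variables. The gap
    of index [a] either is the next mark of the word extended by [a], or takes the
    place of the mark of the first letter greater than [a]; in the latter case the
    letter sum decreases and the displaced mark is the new variable to multiply
    with. *)
Lemma span_mul_var w v : word q w -> P w -> size w = j ->
  in_span J (fun w' => [/\ word q w', P w' & size w' = j.+1]) (mark_prod w * 'X_v).
Proof.
move: {2}(\sum_(l < j) nth 0 w l)%N (leqnn (\sum_(l < j) nth 0 w l)) => k.
elim/ltn_ind: k w v => k IH w v wk ww Pw wj.
have [Jw|good] := P_good ww Pw wj.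
  by apply: in_span_ideal; rewrite mulrC; apply: idealM.
have [x [Jx gx]] := good v.
apply: (@in_span_mod _ _ iJ _ (\sum_v' x v' *: (mark_prod w * 'X_v'))).
  rewrite (eq_bigr (fun v' => mark_prod w * (x v' *: 'X_v'))); last first.
    by move=> v' _; rewrite scalerAr.
  by rewrite -mulr_sumr -mulrBr; apply: idealM.
apply: in_span_sum => // v' _; have [->|/gx] := eqVneq (x v') 0.
  by rewrite scale0r; apply: in_span_ideal; apply: ideal0.
move/in_gaps => [a aq av]; apply: in_spanZ => //.
rewrite -yvar_ord -av /gap; have := countle_size w a.
rewrite leq_eqVlt => /predU1P[nj|nj].
  rewrite nj -mark_prod_rcons; apply: in_span_mark_prod => //.
  split; [exact: word_rcons|by apply: P_extend; rewrite // nj|].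
  by rewrite size_rcons wj.
rewrite -mark_prod_set //.
have [w0w ac] := word_set ww aq nj.
have [->|[v0 _ ->]] := yvarP (mark t w (countle w a)).
  by rewrite mulr0; apply: in_span_ideal; apply: ideal0.
have sz0 := size_set_entry a nj.
apply: (IH _ _ _ _ (leqnn _)) => //; last by rewrite sz0.
  apply: leq_trans wk; rewrite -wj in nj *.
  rewrite (bigD1 (Ordinal nj)) // [ltnRHS](bigD1 (Ordinal nj)) //=.
  rewrite nth_set_nth /= eqxx -addSn leq_add // leq_sum // => l lc.
  by rewrite nth_set_nth /=; rewrite -val_eqE /= in lc; rewrite (negbTE lc).
by apply: P_lower; rewrite // -wj.
Qed.

End Multiply.

Lemma span_mul_monomial J P q j j' w (c : 'X_{1..N}) : is_ideal J ->
  (forall w a, word q w -> P w -> (j <= size w < j')%N -> (a < q)%N ->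
     (countle w a < size w)%N -> P (set_nth 0%N w (countle w a) a)) ->
  (forall w a, word q w -> P w -> (j <= size w < j')%N -> (a < q)%N ->
     countle w a = size w -> P (rcons w a)) ->
  (forall w, word q w -> P w -> (j <= size w < j')%N ->
     J (mark_prod w) \/ gap_spans J q w) ->
  word q w -> P w -> size w = j -> (j + mdeg c = j')%N ->
  in_span J (fun w' => [/\ word q w', P w' & size w' = j']) (mark_prod w * 'X_[c]).
Proof.
move=> iJ Pl Pe Pg ww Pw wj cj.
suff main k c' : mdeg c' = k -> (j + k <= j')%N ->
    in_span J (fun w' => [/\ word q w', P w' & size w' = (j + k)%N])
      (mark_prod w * 'X_[c']).
  by rewrite -cj; apply: main => //; rewrite cj.
elim: k c' => [|k IH] c' c'k jk.
  move/eqP: c'k; rewrite mdeg_eq0 => /eqP ->; rewrite mpolyX0 mulr1 addn0.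
  exact: in_span_mark_prod.
have [i ic' dc] := mdegS_var c'k.
have c'E : c' = (c' - U_(i) + U_(i))%MM by rewrite submK.
rewrite c'E mpolyXD mulrA; apply: in_spanM => //.
  by apply: IH => //; apply: leq_trans jk; rewrite leq_add2l.
move=> w' [ww' Pw' sw']; rewrite addnS; have jw' : (j <= size w' < j')%N.
  by rewrite sw'; lia.
apply: span_mul_var => //.
- by move=> w1 a h1 h2 h3 h4 h5; apply: Pl => //; rewrite h3 //; lia.
- by move=> w1 a h1 h2 h3 h4 h5; apply: Pe => //; rewrite h3 //; lia.
- by move=> w1 h1 h2 h3; apply: Pg => //; rewrite h3; lia.
Qed.

End Span.

(** * General position *)

Section Generic.
Variable K : fieldType.

(** Properties that hold for all but finitely many scalars are given by a finite list
    of exceptions; over an infinite field such properties can be combined. *)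
Lemma cofinite_nonroots (p : {poly K}) : p != 0 ->
  exists s : seq K, forall x, x \notin s -> p.[x] != 0.
Proof.
move: {2}(size p) (leqnn (size p)) => k; elim: k p => [|k IH] p.
  by rewrite leqn0 size_poly_eq0 => ->.
move=> pk p0; have [[x px]|nr] := classic (exists x, root p x); last first.
  by exists [::] => x _; apply: contra_notN nr => px; exists x.
have /factor_theorem[q qE] := px; rewrite qE in p0 pk.
have q0 : q != 0 by apply: contraNneq p0 => ->; rewrite mul0r.
have [|s sP] := IH q _ q0.
  move: pk; rewrite size_Mmonic ?monicXsubC // size_XsubC addn2 /= ltnS.
  exact.
exists (x :: s) => y; rewrite inE negb_or => /andP[yx /sP qy].
by rewrite qE hornerM hornerXsubC mulf_eq0 negb_or qy subr_eq0.
Qed.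

(** Lower semicontinuity of the rank. If C M0 Q is the identity of size the rank of
    M0, then det (C (M0 + x M1) Q) is a polynomial in x with value 1 at 0. *)
Lemma mxrank_line p s (M0 M1 : 'M[K]_(p, s)) :
  exists bad : seq K, forall x, x \notin bad ->
    (\rank M0 <= \rank (M0 + x *: M1)%R)%N.
Proof.
have /submxP[C CE] : (row_base M0 <= M0)%MS by rewrite eq_row_base.
set Q := pinvmx (row_base M0).
have CQ : C *m M0 *m Q = 1%:M by rewrite -CE mulmxVp ?row_base_free.
pose A1 := C *m M1 *m Q.
pose P : {poly K} := \det (map_mx polyC 1%:M + 'X *: map_mx polyC A1).
have PE x : P.[x] = \det (1%:M + x *: A1).
  rewrite -horner_evalE -det_map_mx; congr (\det _); apply/matrixP => i j.
  by rewrite !mxE /= horner_evalE !hornerE.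
have P0 : P != 0.
  apply/eqP => P0; have := PE 0; rewrite P0 horner0 scale0r addr0 det1.
  by move/esym/eqP; rewrite oner_eq0.
have [bad badP] := cofinite_nonroots P0; exists bad => x /badP.
rewrite PE -unitfE => dA.
have rA : \rank (1%:M + x *: A1)%R = \rank M0 by rewrite mxrank_unit ?unitmxE.
rewrite -[leqLHS]rA.
rewrite -CQ /A1 scalemxAl scalemxAr -mulmxDl -mulmxDr.
exact: leq_trans (mxrankM_maxl _ _) (mxrankM_maxr _ _).
Qed.

(** The same at the other end of the line, via x^-1. *)
Lemma mxrank_line_inf p s (M0 M1 : 'M[K]_(p, s)) :
  exists bad : seq K, forall x, x \notin bad ->
    (\rank M1 <= \rank (M0 + x *: M1)%R)%N.
Proof.
have [bad badP] := mxrank_line M1 M0.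
exists (0 :: map GRing.inv bad) => x; rewrite inE negb_or => /andP[x0 xb].
have /badP : x^-1 \notin bad.
  by apply: contra xb => xb; rewrite -[x]invrK map_f.
have -> : M0 + x *: M1 = x *: (M1 + x^-1 *: M0).
  by rewrite scalerDr scalerA mulfV // scale1r addrC.
by rewrite mxrank_scale_nz.
Qed.

Lemma cofinite_forall (T : finType) (P : T -> K -> Prop) :
  (forall y, exists s : seq K, forall x, x \notin s -> P y x) ->
  exists s : seq K, forall x, x \notin s -> forall y, P y x.
Proof.
move=> PT.
suff [s sP] : exists s : seq K, forall x, x \notin s -> forall y, y \in enum T -> P y x.
  by exists s => x /sP h y; apply: h; rewrite mem_enum.
elim: (enum T) => [|y e [s sP]]; first by exists [::].
have [s' s'P] := PT y; exists (s ++ s') => x; rewrite mem_cat negb_or.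
by move=> /andP[xs xs'] z; rewrite inE => /predU1P[->|/sP]; [apply: s'P|apply].
Qed.

Definition off N (C : {set 'I_N}) : 'M[K]_N := diag_mx (\row_v (v \notin C)%:R).

Lemma mulmx_off p N (A : 'M[K]_(p, N)) C i v :
  (A *m off C) i v = A i v *+ (v \notin C).
Proof. by rewrite mul_mx_diag !mxE mulr_natr. Qed.

Lemma off_mulmx p N (A : 'M[K]_(N, p)) C v k :
  (off C *m A) v k = A v k *+ (v \notin C).
Proof. by rewrite mul_diag_mx !mxE mulr_natl. Qed.

(** The linear forms with coefficient rows [Theta], restricted to the vertices off
    [C], span all linear forms in these vertices. *)
Definition spans_off r N (Theta : 'M[K]_(r, N)) (C : {set 'I_N}) : bool :=
  (off C <= Theta *m off C)%MS.

(** By duality it suffices that no nonzero point supported off [C] is a common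
    zero. *)
Lemma spans_offP r N (Theta : 'M[K]_(r, N)) (C : {set 'I_N}) :
  (forall p : 'cV[K]_N, (forall v, v \in C -> p v 0 = 0) -> Theta *m p = 0 -> p = 0) ->
  spans_off Theta C.
Proof.
move=> h; rewrite /spans_off submxE; set M := cokermx _.
have TM : Theta *m off C *m M = 0 by rewrite mulmx_coker.
apply/eqP/matrixP => v k; rewrite [RHS]mxE.
have T0 : Theta *m (off C *m M *m delta_mx k (0 : 'I_1)) = 0.
  by rewrite 2!mulmxA TM mul0mx.
have := h _ _ T0; rewrite -colE => /(_ _)/matrixP/(_ v 0).
rewrite !mxE; apply=> v' v'C; by rewrite mxE off_mulmx v'C.
Qed.

(** A relation between the powers of the [a v] with [v] off [C] is tested on the
    polynomial that vanishes at all of these but one. *)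
Lemma vandermonde_spans_off r N (Theta : 'M[K]_(r, N)) (a : 'I_N -> K)
    (C : {set 'I_N}) s :
  injective a -> (forall k, (k < s)%N -> exists i, forall v, Theta i v = a v ^+ k) ->
  (#|~: C| <= s)%N -> spans_off Theta C.
Proof.
move=> aI Ta Cs; apply: spans_offP => p pC Tp; apply/matrixP => v j.
rewrite [RHS]mxE ord1 {j}; have [/pC//|vC] := boolP (v \in C).
pose g : {poly K} := \prod_(v' in ~: C :\ v) ('X - (a v')%:P).
have sg : (size g <= s)%N.
  rewrite /g -big_enum size_prod_XsubC -cardE; apply: leq_trans Cs.
  by rewrite (cardsD1 v (~: C)) inE vC.
have sum0 : \sum_v' g.[a v'] * p v' 0 = 0.
  rewrite (eq_bigr (fun v' => \sum_(k < s) g`_k * (a v' ^+ k * p v' 0))).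
    rewrite exchange_big big1 //= => k _; rewrite -mulr_sumr.
    have [i iE] := Ta k (ltn_ord k).
    have /matrixP/(_ i 0) := Tp; rewrite !mxE => Ti.
    by rewrite (eq_bigr (fun v' => Theta i v' * p v' 0)) ?Ti ?mulr0 // => v' _; rewrite iE.
  move=> v' _; rewrite (horner_coef_wide _ sg) mulr_suml.
  by apply: eq_bigr => k _; rewrite mulrA.
move: sum0; rewrite (bigD1 v) //= big1 ?addr0 => [/eqP|v' v'v].
  rewrite mulf_eq0 => /orP[|/eqP//]; rewrite horner_prod => /prodf_eq0[v' ].
  rewrite !inE => /andP[v'v _]; rewrite hornerXsubC subr_eq0 => /eqP/aI e.
  by rewrite e eqxx in v'v.
have [/pC ->|v'C] := boolP (v' \in C); first by rewrite mulr0.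
suff -> : g.[a v'] = 0 by rewrite mul0r.
apply/eqP; rewrite horner_prod; apply/prodf_eq0; exists v'.
  by rewrite !inE v'v v'C.
by rewrite hornerXsubC subrr.
Qed.

Hypothesis K_infinite : forall s : seq K, exists x : K, x \notin s.

Lemma distinct_elements N : exists a : 'I_N -> K, injective a.
Proof.
suff [s us sN] : exists2 s : seq K, uniq s & size s = N.
  exists (fun v : 'I_N => nth 0 s v) => u v /eqP.
  by rewrite nth_uniq ?sN ?ltn_ord // => /eqP/val_inj.
elim: N => [|N [s us sN]]; first by exists [::].
have [x xs] := K_infinite s; exists (x :: s); rewrite /= ?xs // sN //.
Qed.

(** On a line in the direction of a Vandermonde matrix, almost all matrices are in
    general position. *)
Lemma generic_line r N (Theta0 : 'M[K]_(r, N)) :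
  exists (Theta1 : 'M[K]_(r, N)) (bad : seq K), forall x, x \notin bad ->
    forall C : {set 'I_N}, (#|~: C| <= r)%N -> spans_off (Theta0 + x *: Theta1) C.
Proof.
have [a aI] := distinct_elements N.
pose Theta1 : 'M[K]_(r, N) := \matrix_(i, v) a v ^+ i; exists Theta1.
apply: cofinite_forall => C; have [Cr|_] := leqP #|~: C| r; last by exists [::].
have := mxrank_line_inf (Theta0 *m off C) (Theta1 *m off C).
move=> [bad badP]; exists bad => x /badP; rewrite scalemxAl -mulmxDl => le1 _.
have nd : spans_off Theta1 C.
  apply: (vandermonde_spans_off aI) Cr => k kr.
  by exists (Ordinal kr) => v; rewrite mxE.
have sub := submxMl (Theta0 + x *: Theta1) (off C).
rewrite /spans_off -(mxrank_leqif_sup sub).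
by rewrite eqn_leq mxrankS //= (leq_trans (mxrankS nd)).
Qed.

(** Semicontinuity for the span of a family of vectors that depends affinely on x. *)
Lemma dim_span_line (vT : vectType K) (T : finType) (F0 F1 : T -> vT) :
  exists bad : seq K, forall x, x \notin bad ->
    (\dim <<[seq F0 y | y : T]>> <= \dim <<[seq (F0 y + x *: F1 y)%R | y : T]>>)%N.
Proof.
pose M (F : T -> vT) : 'M[K]_(#|T|, dim vT) :=
  \matrix_(i < #|T|) v2r (F (enum_val i)).
have dimE F : \dim <<[seq F y | y : T]>> = \rank (M F).
  rewrite /dimv [span]unlock genmxE; apply/eqP; rewrite eqn_leq.
  apply/andP; split; apply/mxrankS/row_subP => i; rewrite rowK.
    have /mapP[y _ ->] := mem_tnth i (in_tuple [seq F y | y : T]).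
    by rewrite -(enum_rankK y) -(rowK (fun i => v2r (F (enum_val i)))) row_sub.
  have /(tnthP (in_tuple _))[k ->] : F (enum_val i) \in [seq F y | y : T].
    exact: image_f.
  by rewrite -(rowK (fun k => v2r (tnth (in_tuple _) k))) row_sub.
have [bad badP] := mxrank_line (M F0) (M F1); exists bad => x /badP.
rewrite !dimE (_ : M F0 + x *: M F1 = M (fun y => F0 y + x *: F1 y)) //.
by apply/matrixP => i j; rewrite !mxE linearD linearZ !mxE.
Qed.

End Generic.

(** * Graded pieces of quotients by linear forms *)

Section LinearForms.
Variables (K : fieldType) (N : nat).
Local Notation S := {mpoly K[N]}.

Definition linform (x : 'rV[K]_N) : S := \sum_v x 0 v *: 'X_v.

Lemma linform_is_linear : linear linform.
Proof.
move=> a x y; rewrite /linform scaler_sumr -big_split /=; apply: eq_bigr => v _.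
by rewrite !mxE scalerDl scalerA.
Qed.
HB.instance Definition _ := GRing.isLinear.Build K _ _ _ linform linform_is_linear.

Lemma linform_delta v : linform (delta_mx 0 v) = 'X_v.
Proof.
rewrite /linform (bigD1 v) //= mxE !eqxx scale1r big1 ?addr0 // => v' v'v.
by rewrite mxE (negbTE v'v) andbF scale0r.
Qed.

Lemma linform_row r s (A : 'M[K]_(r, s)) (B : 'M[K]_(s, N)) i :
  linform (row i (A *m B)) = \sum_k A i k *: linform (row k B).
Proof.
rewrite row_mul mulmx_sum_row linear_sum; apply: eq_bigr => k _.
by rewrite linearZ /= mxE.
Qed.

Lemma homog1_linform (f : S) : f \is 1.-homog ->
  f = linform (\row_v f@_U_(v)).
Proof.
move=> hf; apply/mpolyP => c; rewrite /linform raddf_sum /=.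
have [/mdeg1P[i /eqP ->]|c1] := boolP (mdeg c == 1%N).
  rewrite (bigD1 i) //= mcoeffZ mcoeffX eqxx mulr1 mxE big1 ?addr0 // => v vi.
  by rewrite mcoeffZ mcoeffX eq_mnm1 (negbTE vi) mulr0.
rewrite (dhomog_nemf_coeff hf) // big1 // => v _.
rewrite mcoeffZ mcoeffX; case: eqP => [e|_]; last by rewrite mulr0.
by rewrite -e mdeg1 in c1.
Qed.

Lemma var_homog v : 'X_v \is [in K[N], 1.-homog].
Proof. by rewrite dhomogX; apply/eqP/mdeg1. Qed.

Lemma linform_homog x : linform x \is 1.-homog.
Proof. by rewrite /linform rpred_sum // => v _; rewrite rpredZ // var_homog.
Qed.

Lemma monomial_form_homog c x : 'X_[c] * linform x \is (mdeg c).+1.-homog.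
Proof.
have := dhomogM (_ : 'X_[c] \is (mdeg c).-homog) (linform_homog x).
by rewrite addn1; apply; rewrite dhomogX.
Qed.

(** Independence of forms off the gaps allows to eliminate all variables but those at
    the gaps. *)
Lemma gap_spans_spans_off t q w r (Theta : 'M[K]_(r, N)) (J : S -> Prop) :
  is_ideal J -> (forall i, J (linform (row i Theta))) ->
  spans_off Theta (gaps t N q w) -> gap_spans t J q w.
Proof.
move=> iJ JT /submxP[D DE] v; set x := delta_mx 0 v - row v D *m Theta.
exists (x 0); split; last first.
  move=> v' xv'; apply: contraNT xv' => v'C.
  have : (x *m off K (gaps t N q w)) 0 v' = 0.
    by rewrite /x mulmxBl -rowE {1}DE -mulmxA -row_mul subrr mxE.
  by rewrite mulmx_off v'C mulr1n => ->.
rewrite -/(linform x) /x linearB /= linform_delta opprB addrC subrK.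
rewrite -row_mul linform_row; apply: ideal_sum => // i _.
by rewrite -mul_mpolyC; apply: idealM.
Qed.

End LinearForms.

Section Graded.
Variables (K : fieldType) (N' : nat).
Local Notation N := N'.+1.
Local Notation S := {mpoly K[N]}.
Implicit Types (Delta : {set {set 'I_N}}) (f g : S).

Definition hpart j f : dhomog N K j := DHomog (pihomogP mdeg j f).

Lemma hpart_is_linear j : linear (hpart j).
Proof. by move=> a f g; apply: val_inj; rewrite /= linearP. Qed.
HB.instance Definition _ j :=
  GRing.isLinear.Build K S (dhomog N K j) _ (hpart j) (hpart_is_linear j).

Lemma hpart_homog j f : f \is j.-homog -> val (hpart j f) = f.
Proof. exact: pihomog_dE. Qed.

Lemma hpart_val j (v : dhomog N K j) : hpart j (val v) = v.
Proof. by apply: val_inj; apply: hpart_homog; apply: dhomog_is_dhomog. Qed.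

Lemma hpart_ne j j' f : j' != j -> f \is j'.-homog -> hpart j f = 0.
Proof. by move=> jj hf; apply: val_inj; apply: pihomog_ne0 hf. Qed.

Lemma hpart_id_or_0 j j' f : f \is j'.-homog ->
  pihomog mdeg j f = f \/ pihomog mdeg j f = 0.
Proof.
move=> hf; have [<-|jj] := eqVneq j' j; first by left; apply: pihomog_dE.
by right; apply: pihomog_ne0 hf.
Qed.

Definition msupport (c : 'X_{1..N}) : {set 'I_N} := [set v | c v != 0%N].

Definition linear_quotient_ideal Delta r (Theta : 'M[K]_(r, N)) : S -> Prop :=
  ideal_add (@stanley_reisner K _ Delta) (fun i => linform (row i Theta)).

(** Generators of the degree j part of the ideal. Monomials of the wrong degree have
    no part of degree j, which saves a condition on the degree. *)
Definition piece_gen Delta r (Theta : 'M[K]_(r, N)) j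
    (x : 'X_{1..N < j.+1} + 'X_{1..N < j.+1} * 'I_r) : dhomog N K j :=
  match x with
  | inl c => if msupport c \in Delta then 0 else hpart j 'X_[c]
  | inr (c, i) => hpart j ('X_[c] * linform (row i Theta))
  end.

Definition piece Delta r (Theta : 'M[K]_(r, N)) j : {vspace dhomog N K j} :=
  <<[seq piece_gen Delta Theta x | x : 'X_{1..N < j.+1} + 'X_{1..N < j.+1} * 'I_r]>>%VS.

Definition down_closed Delta : Prop :=
  forall A B : {set 'I_N}, A \subset B -> B \in Delta -> A \in Delta.

Section Piece.
Variables (Delta : {set {set 'I_N}}) (r : nat) (Theta : 'M[K]_(r, N)).
Hypothesis Delta_down : down_closed Delta.
Local Notation J := (linear_quotient_ideal Delta Theta).

Lemma linear_quotient_is_ideal : is_ideal J.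
Proof. exact: ideal_gen_ideal. Qed.

Lemma linear_quotient_form i : J (linform (row i Theta)).
Proof. by apply: ideal_gen_mem; right; exists i. Qed.

Lemma prod_var_set (A : {set 'I_N}) : \prod_(v in A) 'X_v = 'X_[mesym1 A] :> S.
Proof.
rewrite [RHS]mpolyXE_id big_mkcond /=; apply: eq_bigr => v _.
by rewrite mnmE; case: (v \in A); rewrite ?expr1 ?expr0.
Qed.

Lemma monomial_nonface (A : {set 'I_N}) (c : 'X_{1..N}) :
  A \subset msupport c -> A \notin Delta -> (@stanley_reisner K _ Delta) 'X_[c].
Proof.
move=> Ac AD.
have -> : 'X_[c] = 'X_[c - mesym1 A] * \prod_(v in A) 'X_v :> S.
  rewrite prod_var_set -mpolyXD submK //; apply/mnm_lepP => v; rewrite mnmE.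
  by case: (boolP (v \in A)) => // /(subsetP Ac); rewrite inE lt0n.
apply: idealM; first exact: ideal_gen_ideal.
by apply: ideal_gen_mem; exists A.
Qed.

Lemma linear_quotient_nonface (A : {set 'I_N}) (c : 'X_{1..N}) :
  A \subset msupport c -> A \notin Delta -> J 'X_[c].
Proof. by move=> Ac AD; apply: ideal_gen_mem; left; apply: monomial_nonface Ac AD. Qed.

Lemma mpoly_linear_ind (P : S -> Prop) (f : S) : P 0 ->
  (forall g h, P g -> P h -> P (g + h)) -> (forall a c, P (a *: 'X_[c])) -> P f.
Proof.
by move=> P0 PD PX; rewrite [f]mpolyE; elim/big_ind: _ => // c _; apply: PX.
Qed.

(** Membership is tested on all multiples of [f] at once: this condition is an ideal,
    so that it is enough to look at generators, and it is linear in the multiplier, so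
    that it is enough to multiply with monomials. *)
Lemma mem_piece j f : J f -> hpart j f \in piece Delta Theta j.
Proof.
pose E g := forall h i, hpart i (h * g) \in piece Delta Theta i.
suff JE g : J g -> E g by move/JE/(_ 1); rewrite mul1r; apply.
have iE : is_ideal E.
  split=> [h i|g1 g2 E1 E2 h i|g1 g2 E2 h i].
  - by rewrite mulr0 linear0 mem0v.
  - by rewrite mulrDr linearD; apply: memvD; [apply: E1|apply: E2].
  - by rewrite mulrA; apply: E2.
have lin g0 : (forall c i, hpart i ('X_[c] * g0) \in piece Delta Theta i) -> E g0.
  move=> h0 h i; elim/mpoly_linear_ind: h => [|g1 g2|a c].
  - by rewrite mul0r linear0 mem0v.
  - by rewrite mulrDl linearD; apply: memvD.
  - by rewrite -scalerAl linearZ; apply: memvZ; apply: h0.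
apply: ideal_gen_sub => // {}g [|[k ->]].
  apply: ideal_gen_sub => // _ [A AD ->]; apply: lin => c i.
  rewrite prod_var_set -mpolyXD; set c' := (c + _)%MM.
  have [c'i|c'i] := eqVneq (mdeg c') i; last first.
    by rewrite (hpart_ne c'i) ?mem0v // dhomogX.
  have c'lt : (mdeg c' < i.+1)%N by rewrite c'i.
  apply: memv_span; apply/mapP; exists (inl (BMultinom c'lt)).
    by rewrite mem_enum.
  rewrite /= ifN //; apply: contra AD; apply: Delta_down; apply/subsetP => v vA.
  by rewrite inE mnmDE mnmE vA addn1.
apply: lin => c i.
have [ci|ci] := eqVneq (mdeg c).+1 i; last first.
  by rewrite (hpart_ne ci) ?mem0v // monomial_form_homog.
have clt : (mdeg c < i.+1)%N by rewrite -ci; lia.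
by apply: memv_span; apply/mapP; exists (inr (BMultinom clt, k)); rewrite ?mem_enum.
Qed.

Lemma piece_ideal j v : v \in piece Delta Theta j -> J (val v).
Proof.
have iJ := linear_quotient_is_ideal.
move=> /(@coord_span _ _ _ (in_tuple _)) ->; rewrite raddf_sum /=.
apply: (ideal_sum iJ) => i _ /=; rewrite -mul_mpolyC; apply: idealM => //.
have /mapP[x _ ->] := mem_nth 0 (ltn_ord i).
case: x => [c|[c k]] /=.
  case: ifP => [_|/negbT cD]; first exact: ideal0.
  rewrite /= pihomogX; case: ifP => _; last exact: ideal0.
  exact: linear_quotient_nonface (subxx _) cD.
have [->|->] := hpart_id_or_0 j (monomial_form_homog c (row k Theta)).
  by apply: idealM => //; apply: linear_quotient_form.
exact: ideal0.
Qed.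

Lemma piece_val j (v : dhomog N K j) : J (val v) <-> v \in piece Delta Theta j.
Proof.
by split=> [/(mem_piece j)|]; [rewrite hpart_val|apply: piece_ideal].
Qed.

Lemma mark_prod_homog t w : (forall l, (l < size w)%N -> (mark t w l < N)%N) ->
  mark_prod K N t w \is (size w).-homog.
Proof.
move=> wN; rewrite /mark_prod; elim: (size w) wN => [|k IH] wN.
  by rewrite big_ord0 dhomog1.
have v_homog : yvar K N (mark t w k) \is 1.-homog.
  by rewrite -[mark t w _]/(val (Ordinal (wN k (ltnSn k)))) yvar_ord var_homog.
rewrite big_ord_recr; have := dhomogM (IH _) v_homog; rewrite addn1; apply.
by move=> l lk; apply: wN; apply: ltnW.
Qed.

Lemma hpart_in_span j t (ws : seq (seq nat)) (P : seq nat -> Prop) f :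
  (forall w, P w -> J (mark_prod K N t w) \/ w \in ws) ->
  in_span t J P f -> hpart j f \in
    (piece Delta Theta j + <<[seq hpart j (mark_prod K N t w) | w <- ws]>>)%VS.
Proof.
move=> Pws [s [Ps Js]]; have -> : f = f - \sum_(x <- s) x.1 *: mark_prod K N t x.2
  + \sum_(x <- s) x.1 *: mark_prod K N t x.2 by rewrite subrK.
rewrite linearD /= memvD //; first by apply: (subvP (addvSl _ _)); apply: mem_piece.
rewrite linear_sum /= big_seq memv_suml // => x /Ps/Pws Jx; rewrite linearZ memvZ //=.
case: Jx => [Jx|xw]; first by apply: (subvP (addvSl _ _)); apply: mem_piece.
by apply: (subvP (addvSr _ _)); apply/memv_span/map_f.
Qed.

Lemma fullv_span_monomials j : fullv = <<[seq hpart j 'X_[c] | c : 'X_{1..N < j.+1}]>>%VS.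
Proof.
apply/eqP; rewrite eqEsubv subvf andbT; apply/subvP => v _.
rewrite -[v]hpart_val; elim/mpoly_linear_ind: (val v) => [|g h|a c].
- by rewrite linear0 mem0v.
- by rewrite linearD; apply: memvD.
rewrite linearZ memvZ //=; have [cj|cj] := eqVneq (mdeg c) j; last first.
  by rewrite (hpart_ne cj) ?mem0v // dhomogX.
have clt : (mdeg c < j.+1)%N by rewrite cj.
by apply: memv_span; apply/mapP; exists (BMultinom clt); rewrite ?mem_enum.
Qed.

Lemma dim_le_span j t (ws : seq (seq nat)) (P : seq nat -> Prop) :
  (forall w, P w -> J (mark_prod K N t w) \/ w \in ws) ->
  (forall c, mdeg c = j -> in_span t J P 'X_[c]) ->
  (\dim (fullv : {vspace dhomog N K j}) <= \dim (piece Delta Theta j) + size ws)%N.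
Proof.
move=> Pws Xj; set B := <<[seq hpart j (mark_prod K N t w) | w <- ws]>>%VS.
have full : (fullv <= piece Delta Theta j + B)%VS.
  rewrite fullv_span_monomials; apply/span_subvP => _ /mapP[c _ ->].
  have [cj|cj] := eqVneq (mdeg c) j; last by rewrite (hpart_ne cj) ?mem0v // dhomogX.
  exact: (hpart_in_span _ Pws (Xj _ cj)).
apply: leq_trans (dimvS full) _; apply: leq_trans (dimv_add_leqif _ _) _.
by rewrite leq_add2l (leq_trans (dim_span _)) // size_map.
Qed.

End Piece.

(** With [setT] as complex the Stanley-Reisner ideal vanishes, so [piece setT Theta j]
    is the ideal of the linear forms alone. *)
Lemma piece_le j r (Theta : 'M[K]_(r, N)) Delta t (ws : seq (seq nat))
    (P : seq nat -> Prop) :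
  (forall w, P w -> w \in ws) ->
  (forall c, mdeg c = j -> msupport c \notin Delta ->
     in_span t (linear_quotient_ideal setT Theta) P 'X_[c]) ->
  (\dim (piece Delta Theta j) <= \dim (piece setT Theta j) + size ws)%N.
Proof.
move=> Pws Xj; set B := <<[seq hpart j (mark_prod K N t w) | w <- ws]>>%VS.
have down : down_closed setT by move=> A B'; rewrite !inE.
have sub : (piece Delta Theta j <= piece setT Theta j + B)%VS.
  apply/span_subvP => _ /mapP[x _ ->]; case: x => [c|[c i]] /=.
    case: ifP => [_|/negbT cD]; first exact: mem0v.
    have [cj|cj] := eqVneq (mdeg c) j; last by rewrite (hpart_ne cj) ?mem0v // dhomogX.
    have Q w : P w -> linear_quotient_ideal setT Theta (mark_prod K N t w) \/ w \in ws.
      by move=> /Pws; right.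
    exact: (hpart_in_span down j Q (Xj _ cj cD)).
  apply: (subvP (addvSl _ _)); apply: mem_piece => //.
  by apply: idealM; [apply: ideal_gen_ideal|apply: linear_quotient_form].
apply: leq_trans (dimvS sub) _; apply: leq_trans (dimv_add_leqif _ _) _.
by rewrite leq_add2l (leq_trans (dim_span _)) // size_map.
Qed.

End Graded.

(** * Hilbert functions *)

Lemma rank_off (K : fieldType) N (C : {set 'I_N}) : (#|~: C| <= \rank (off K C))%N.
Proof.
pose A : 'M[K]_(#|~: C|, N) := \matrix_i delta_mx 0 (enum_val i).
have AE : A *m off K C *m A^T = 1%:M.
  apply/matrixP => i k; rewrite !mxE (bigD1 (enum_val k)) //= big1 => [|v vk].
    rewrite addr0 mulmx_off !mxE !eqxx /= mulr1.
    have := enum_valP k; rewrite inE => ->; rewrite mulr1n.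
    by rewrite (inj_eq enum_val_inj) eq_sym.
  have -> : A^T v k = 0 by rewrite !mxE (negbTE vk) ?andbF.
  by rewrite mulr0.
rewrite -{1}(mxrank1 K #|~: C|) -AE.
exact: leq_trans (mxrankM_maxl _ _) (mxrankM_maxr _ _).
Qed.

Section FreeQuotient.
Variables (K : fieldType) (N' : nat).
Local Notation N := N'.+1.
Local Notation S := {mpoly K[N]}.

(** When the number of forms is that of the vertices off [C], the forms can be solved
    for these vertices. *)
Lemma spans_off_elim r (Theta : 'M[K]_(r, N)) (C : {set 'I_N}) :
  spans_off Theta C -> #|~: C| = r ->
  exists D : 'M[K]_(N, r), Theta *m D = 1%:M /\ forall v, v \in C -> row v D = 0.
Proof.
move=> /submxP[D DE] Cr; exists D.
have free : row_free (Theta *m off K C).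
  rewrite /row_free eqn_leq rank_leq_row -{1}Cr (leq_trans (rank_off K C)) //.
  by rewrite {1}DE mxrankM_maxr.
split=> [|v vC]; apply: (row_free_inj free); first by rewrite /= -mulmxA -DE mul1mx.
rewrite /= mul0mx -row_mul -DE; apply/rowP => k; rewrite !mxE.
by rewrite vC mul0rn.
Qed.

(** Modulo the forms, S is a polynomial ring in the first [q] variables: solving the
    forms for the other variables gives a substitution [psi] that kills the forms and
    fixes the first [q] variables, so the monomials in these stay independent modulo
    the forms. *)
Lemma dim_piece_setT q r (Theta : 'M[K]_(r, N)) j (ws : seq (seq nat)) :
  (r + q = N)%N -> spans_off Theta [set v : 'I_N | (v < q)%N] ->
  uniq ws -> (forall w, w \in ws -> word q w /\ size w = j) ->
  (\dim (piece setT Theta j) + size ws <= \dim (fullv : {vspace dhomog N K j}))%N.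
Proof.
move=> rq sT uws wsP; set C := [set v | _] in sT.
have Cr : #|~: C| = r.
  by rewrite cardsCs setCK card_ord card_initial; lia.
have [D [TD DC]] := spans_off_elim sT Cr.
pose psi (f : S) : S := f \mPo [tuple linform (delta_mx 0 v - row v D *m Theta) | v < N].
have psi_X (v : 'I_N) : psi 'X_v = linform (delta_mx 0 v - row v D *m Theta).
  by rewrite /psi comp_mpolyXU -tnth_nth tnth_mktuple.
have psi_fix (v : 'I_N) : (v < q)%N -> psi 'X_v = 'X_v.
  by move=> vq; rewrite psi_X DC ?inE // mul0mx subr0 linform_delta.
have psi_form x : psi (linform x) = linform (x - x *m D *m Theta).
  rewrite {1}/linform /psi raddf_sum /=.
  rewrite (eq_bigr (fun v => x 0 v *: linform (delta_mx 0 v - row v D *m Theta))).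
    rewrite -(eq_bigr _ (fun v _ => linearZ _ _)) -raddf_sum; congr linform.
    rewrite -mulmxA [in RHS]mulmx_sum_row {2}[x]row_sum_delta -sumrB /=.
    by apply: eq_bigr => v _; rewrite scalerBr row_mul.
  by move=> v _; rewrite comp_mpolyZ -/(psi _) psi_X.
have psi_row i : psi (linform (row i Theta)) = 0.
  by rewrite psi_form -row_mul TD -row_mul mul1mx subrr linear0.
have psi_lin : linear (fun v : dhomog N K j => hpart j (psi (val v))).
  by move=> a x y; rewrite /psi /= linearP /= linearP.
pose F : {linear dhomog N K j -> dhomog N K j} :=
  HB.pack (fun v : dhomog N K j => hpart j (psi (val v)))
   (GRing.isLinear.Build K _ _ _ _ psi_lin).
have ker : (piece setT Theta j <= lker (linfun F))%VS.
  apply/span_subvP => _ /mapP[x _ ->]; rewrite memv_ker lfunE /=.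
  case: x => [c|[c i]] /=; first by rewrite inE raddf0 /psi /= linear0 linear0.
  have [->|->] := hpart_id_or_0 j (monomial_form_homog c (row i Theta)).
    by rewrite /psi rmorphM /= -!/(psi _) psi_row mulr0 linear0.
  by rewrite /psi linear0 linear0.
pose X := [seq hpart j ('X_[mon N w] : S) | w <- ws].
have homX w : w \in ws -> ('X_[mon N w] : S) \is j.-homog.
  move=> /wsP[ww wj]; rewrite dhomogX; apply/eqP; rewrite -wj; apply: mdeg_mon.
  by apply: wordW ww; lia.
have im : (<<X>> <= limg (linfun F))%VS.
  apply/span_subvP => _ /mapP[w wws ->]; have [ww wj] := wsP w wws.
  apply/memv_imgP; exists (hpart j 'X_[mon N w]); rewrite ?memvf // lfunE /=.
  congr (hpart j _); rewrite pihomog_dE ?homX // mpolyXE_id /psi rmorph_prod.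
  apply: eq_bigr => v _; rewrite rmorphXn /= -/(psi _).
  have [vq|qv] := ltnP v q; first by rewrite psi_fix.
  suff -> : mon N w v = 0%N by rewrite !expr0.
  rewrite mnmE; apply/count_memPn; apply/negP => vw.
  by case/andP: ww => _ /allP/(_ _ vw) /=; rewrite ltnNge qv.
have freeX : free X.
  rewrite -[X]in_tupleE; apply/freeP => k; set sX := size X => k0 i.
  have sXE : sX = size ws by rewrite /sX size_map.
  have iws : (i < size ws)%N by rewrite -sXE.
  have /(congr1 val)/(congr1 (mcoeff (mon N (nth [::] ws i)))) := k0.
  rewrite raddf_sum raddf_sum mcoeff0 (bigD1 i) //= big1 => [|l li].
    rewrite addr0 (nth_map [::]) // hpart_homog ?homX ?mem_nth //.
    by rewrite mcoeffZ mcoeffX eqxx mulr1.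
  have lws : (l < size ws)%N by rewrite -sXE.
  rewrite (nth_map [::]) // hpart_homog ?homX ?mem_nth //.
  rewrite mcoeffZ mcoeffX; case: eqP => [e|]; last by rewrite mulr0.
  have [w1 _] := wsP _ (mem_nth [::] lws); have [w2 _] := wsP _ (mem_nth [::] iws).
  have qN : (q <= N)%N by lia.
  have /eqP := mon_inj qN w1 w2 e; rewrite nth_uniq // => /eqP/val_inj le.
  by rewrite le eqxx in li.
rewrite -(limg_ker_dim (linfun F) fullv) capfv leq_add ?dimvS //.
have -> : size ws = \dim <<X>> by move/eqP: freeX => ->; rewrite size_map.
by rewrite dimvS.
Qed.

End FreeQuotient.

Section WordList.
Variables (m q j : nat).

(** The monomials of bounded degree serve only as a finite type to filter. *)
Definition words : seq (seq nat) :=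
  [seq w <- [seq word_of (val u) | u : 'X_{1..m < j.+1}] | word q w && (size w == j)].

Lemma uniq_words : uniq words.
Proof.
rewrite filter_uniq // map_inj_uniq ?enum_uniq // => u v /word_of_inj.
exact: val_inj.
Qed.

Lemma mem_words w : (q <= m)%N -> (w \in words) = word q w && (size w == j).
Proof.
move=> qm; rewrite mem_filter; apply: andb_idr => /andP[ww /eqP wj].
have wm := wordW qm ww; apply/mapP.
have wlt : (mdeg (mon m w) < j.+1)%N by rewrite mdeg_mon // wj.
by exists (BMultinom wlt); rewrite ?mem_enum //= monK.
Qed.

Lemma count_words (U : {fset 'X_{1..m}}) : (q <= m)%N ->
  count (fun w => mon m w \in U) words =
  count (fun u => (mdeg u == j) && word q (word_of u)) U.
Proof.
move=> qm; rewrite -2!size_filter -[RHS](size_map (@word_of m)).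
apply/perm_size/uniq_perm.
- by rewrite filter_uniq // uniq_words.
- by rewrite map_inj_uniq ?filter_uniq ?fset_uniq //; apply: word_of_inj.
move=> w; rewrite mem_filter mem_words //; apply/idP/mapP => [|[u]].
  case/and3P=> wU ww /eqP wj; have wm := wordW qm ww.
  by exists (mon m w); rewrite ?monK // mem_filter wU mdeg_mon // wj eqxx monK ?ww.
rewrite mem_filter => /andP[/andP[/eqP uj wu] uU] ->.
by rewrite word_ofK uU wu size_word_of uj eqxx.
Qed.

End WordList.

Lemma in_span_sub (K : fieldType) N t (J : {mpoly K[N]} -> Prop)
    (P Q : seq nat -> Prop) f :
  (forall w, P w -> Q w) -> in_span t J P f -> in_span t J Q f.
Proof. by move=> PQ [s [Ps Js]]; exists s; split=> // x /Ps/PQ. Qed.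

Section HilbertFunction.
Variables (K : fieldType) (m : nat) (U : {fset 'X_{1..m}}) (t N' : nat).
Local Notation N := N'.+1.
Local Notation S := {mpoly K[N]}.
Variable Delta : {set {set 'I_N}}.
Hypotheses (U_ideal : order_ideal U) (U_shifted : shifted U).
Hypothesis N_def : N = (m + t + dmax U)%N.
Hypothesis Delta_def :
  Delta = [set A : {set 'I_N} | [exists u : U, A \subset ~: gaps t N m (word_of (val u))]].

(** The Hilbert function of the Stanley-Reisner ring modulo N - q general linear
    forms, in degree j. *)
Definition hilb q j := count (fun u => (mdeg u == j) && word q (word_of u)) U.

Lemma hilb_gt_dmax q j : (dmax U < j)%N -> hilb q j = 0%N.
Proof.
move=> dj; apply/eqP; rewrite -leqn0 leqNgt -has_count; apply/hasPn => u /mdeg_dmax ud.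
by apply/negP => /andP[/eqP uj _]; rewrite uj leqNgt dj in ud.
Qed.

Lemma Delta_down : down_closed Delta.
Proof. by move=> A B; apply: (Delta_sub Delta_def). Qed.

(** The marks of a word are distinct. *)
Lemma mark_prodE w : word m w -> (forall l, (l < size w)%N -> (mark t w l < N)%N) ->
  mark_prod K N t w = 'X_[mesym1 (marks t N w)].
Proof.
move=> ww wN; pose f (l : 'I_(size w)) : 'I_N := Ordinal (wN l (ltn_ord l)).
have fI : injective f.
  move=> a b /(congr1 val) /= ab; apply: val_inj; case: (ltngtP a b) => // lt.
    by have := mark_ltn t ww lt (ltn_ord b); rewrite ab ltnn.
  by have := mark_ltn t ww lt (ltn_ord a); rewrite ab ltnn.
rewrite -prod_var_set /mark_prod (eq_bigr (fun l => 'X_(f l))); last first.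
  by move=> l _; rewrite -yvar_ord.
rewrite -(big_imset (fun v => 'X_v)) /=; last by move=> a b _ _; apply: fI.
apply: eq_bigl => v.
apply/imsetP/in_marks => [[l _ ->]|[l lw e]]; first by exists l.
by exists (Ordinal lw) => //; apply: val_inj; rewrite /= e.
Qed.

Lemma mark_prod_nonface w r (Theta : 'M[K]_(r, N)) : word m w -> mon m w \notin U ->
  linear_quotient_ideal Delta Theta (mark_prod K N t w).
Proof.
move=> ww wU; have iJ := linear_quotient_is_ideal Delta Theta.
have [wN|] := boolP (all (fun l => mark t w l < N)%N (iota 0 (size w))).
  have wN' l : (l < size w)%N -> (mark t w l < N)%N.
    by move=> lw; apply: (allP wN); rewrite mem_iota.
  rewrite mark_prodE //; apply: (linear_quotient_nonface _ (A := marks t N w)).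
    by apply/subsetP => v; rewrite !inE => vm; rewrite mnmE inE vm.
  exact: (word_nonface U_ideal U_shifted Delta_def).
case/allPn => l; rewrite mem_iota /= -leqNgt => lw Nl.
rewrite /mark_prod (bigD1 (Ordinal lw)) //= /yvar insubN -?leqNgt //.
by rewrite mul0r; apply: ideal0.
Qed.

(** Starting from the empty word, the exchange lemma writes every monomial as a
    combination of B_w, and those with w outside U are in the ideal. *)
Lemma hilb_upper q r (Theta : 'M[K]_(r, N)) j : (q <= m)%N ->
  (forall u, u \in U -> word q (word_of u) ->
     spans_off Theta (gaps t N q (word_of u))) ->
  (\dim (fullv : {vspace dhomog N K j}) <= \dim (piece Delta Theta j) + hilb q j)%N.
Proof.
move=> qm sT; have iJ := linear_quotient_is_ideal Delta Theta.
rewrite /hilb -count_words // -size_filter.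
apply: (dim_le_span Delta_down (t := t)
   (P := fun w => [/\ word q w, True & size w = j])) => [w [ww _ wj]|c cj].
  have [wU|wU] := boolP (mon m w \in U); last first.
    by left; apply: mark_prod_nonface => //; apply: wordW ww.
  by right; rewrite mem_filter wU mem_words // ww wj eqxx.
have : in_span t (linear_quotient_ideal Delta Theta)
    (fun w => [/\ word q w, True & size w = j]) (mark_prod K N t [::] * 'X_[c]).
  apply: (span_mul_monomial (P := fun=> True) (j := 0)) => // w ww _ _.
  have wm := wordW qm ww.
  have [wU|wU] := boolP (mon m w \in U); last by left; apply: mark_prod_nonface.
  right; apply: (gap_spans_spans_off iJ (@linear_quotient_form _ _ _ _ Theta)).
  by rewrite -(monK wm); apply: sT; rewrite // monK.
by rewrite /mark_prod big_ord0 mul1r.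
Qed.

(** A monomial with nonface support is a multiple of some B_w with w outside U. When
    [w] has letters that are not below [q], only the part [w'] with letters below [q]
    can be kept, and the exchange lemma is run from B_w'. The words it produces stay
    below [w] letter by letter, as the lost letters are at least [q]; so they are
    outside U once they are as long as [w]. *)
Lemma nonface_span q r (Theta : 'M[K]_(r, N)) j c : (q <= m)%N -> (r + q = N)%N ->
  (j <= dmax U)%N -> (forall C : {set 'I_N}, (#|~: C| <= r)%N -> spans_off Theta C) ->
  mdeg c = j -> msupport c \notin Delta ->
  in_span t (linear_quotient_ideal setT Theta)
    (fun w => [/\ word q w, size w = j & mon m w \notin U]) 'X_[c].
Proof.
move=> qm rq jd gen cj /(nonface_word Delta_def)[w [ww wU mc wN]].
have iJ := linear_quotient_is_ideal setT Theta.
pose k := find (fun a => q <= a)%N w; pose w' := take k w.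
have kw : (k <= size w)%N by apply: find_size.
have sw' : size w' = k by rewrite size_takel.
have split_c w1 : word m w1 -> (forall l, (l < size w1)%N -> (mark t w1 l < N)%N) ->
    marks t N w1 \subset msupport c ->
    exists2 c1, 'X_[c] = mark_prod K N t w1 * 'X_[c1] & (size w1 + mdeg c1 = j)%N.
  move=> ww1 w1N mc1; pose e := mesym1 (marks t N w1).
  have ec : (e <= c)%MM.
    apply/mnm_lepP => v; rewrite mnmE; case: (boolP (v \in marks t N w1)) => //.
    by move/(subsetP mc1); rewrite inE lt0n.
  have eE : mdeg e = size w1.
    by have := mark_prod_homog K w1N; rewrite mark_prodE // dhomogX => /eqP.
  exists (c - e)%MM; first by rewrite mark_prodE // -mpolyXD addmC submK.
  by rewrite -eE -mdegD addmC submK.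
have wj : (size w <= j)%N by have [c1 _ <-] := split_c w ww wN mc; rewrite leq_addr.
have nth_w' l : (l < k)%N -> nth 0%N w' l = nth 0%N w l by move=> lk; apply: nth_take.
have qw l : (k <= l)%N -> (l < size w)%N -> (q <= nth 0 w l)%N.
  move=> kl lw; apply: leq_trans (word_leq_nth ww kl lw).
  by apply: (nth_find 0%N); rewrite has_find; apply: leq_ltn_trans kl lw.
have ww' : word q w'.
  have /andP[sw _] := ww; rewrite /word take_sorted //=.
  apply/(all_nthP 0%N) => l; rewrite sw' => lk; rewrite nth_w' // ltnNge.
  by rewrite (before_find 0%N lk).
have w'N l : (l < size w')%N -> (mark t w' l < N)%N.
  by rewrite sw' => lk; rewrite /mark nth_w' // wN //; apply: leq_trans kw.
have mc' : marks t N w' \subset msupport c.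
  apply: subset_trans mc; apply/subsetP => v /in_marks[l lw' e].
  rewrite sw' in lw'; apply/in_marks; exists l; first exact: leq_trans kw.
  by rewrite -e /mark nth_w'.
have [c1 -> c1j] := split_c w' (wordW qm ww') w'N mc'.
pose P w1 := (k <= size w1)%N /\
  forall l, (l < size w)%N -> (l < size w1)%N -> (nth 0%N w1 l <= nth 0%N w l)%N.
apply: (@in_span_sub _ _ _ _ (fun w1 => [/\ word q w1, P w1 & size w1 = j])).
  move=> w1 [ww1 [kw1 le1] w1j]; split=> //; apply: contra wU.
  apply: (dominated_in U_ideal U_shifted ww (wordW qm ww1)).
  by apply/dominatedP; rewrite w1j; split=> // l lw; apply: le1; rewrite // w1j (leq_trans lw).
apply: (span_mul_monomial (j := k)) => //.
- move=> w1 a ww1 [kw1 le1] _ aq lw1; have [_ alt] := word_set ww1 aq lw1.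
  split=> [|l]; rewrite size_set_entry // => lw lw1'.
  rewrite nth_set_nth /=; case: eqP => [e|_]; last exact: le1.
  by apply: leq_trans (ltnW alt) _; rewrite -e; apply: le1.
- move=> w1 a ww1 [kw1 le1] _ aq _; split=> [|l lw].
    by rewrite size_rcons; apply: leqW.
  rewrite size_rcons ltnS nth_rcons leq_eqVlt => /predU1P[e|lw1].
    rewrite e ltnn eqxx -e; apply: leq_trans (ltnW aq) _; apply: qw => //.
    by rewrite e.
  by rewrite lw1; apply: le1.
- move=> w1 ww1 _ /andP[_ w1j]; right.
  apply: (gap_spans_spans_off iJ (@linear_quotient_form _ _ _ _ Theta)).
  apply: gen; rewrite cardsCs setCK card_ord card_gaps; first by rewrite -rq addnK.
  have w1d : (size w1 <= dmax U)%N by lia.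
  have := shift_leq t w1d; have := shift_max t (dmax U); rewrite N_def; lia.
- split=> [|l lw]; rewrite sw' // => lk; by rewrite nth_w'.
- by rewrite -sw'.
Qed.

Hypothesis K_infinite : forall s : seq K, exists x : K, x \notin s.

(** For forms in general position, count with [nonface_span] and [dim_piece_setT].
    Arbitrary forms are reached by specialization, where the dimension of the ideal
    can only drop. *)
Lemma hilb_lower q r (Theta : 'M[K]_(r, N)) j : (q <= m)%N -> (r + q = N)%N ->
  (\dim (piece Delta Theta j) + hilb q j <= \dim (fullv : {vspace dhomog N K j}))%N.
Proof.
move=> qm rq; have [jd|dj] := leqP j (dmax U); last first.
  by rewrite hilb_gt_dmax // addn0 dimvS ?subvf.
rewrite /hilb -count_words //.
have [Theta1 [bad badP]] := generic_line K_infinite Theta.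
pose F1 (x : 'X_{1..N < j.+1} + 'X_{1..N < j.+1} * 'I_r) : dhomog N K j :=
  match x with
  | inl c => 0
  | inr (c, i) => hpart j ('X_[c] * linform (row i Theta1))
  end.
have [bad' bad'P] := dim_span_line (piece_gen Delta Theta (j := j)) F1.
have [x] := K_infinite (bad ++ bad'); rewrite mem_cat negb_or => /andP[/badP gen /bad'P].
rewrite (_ : <<[seq (_ + _)%R | _ : _]>>%VS = piece Delta (Theta + x *: Theta1) j); last first.
  congr (span _); apply: eq_map => -[c|[c i]] /=.
    by rewrite scaler0 addr0.
  have -> : row i (Theta + x *: Theta1) = row i Theta + x *: row i Theta1.
    by apply/rowP => k; rewrite !mxE.
  rewrite addrC [X in _ = hpart _ (_ * linform X)]addrC linform_is_linear.
  by rewrite mulrDr -scalerAr linearD linearZ.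
rewrite -/(piece Delta Theta j) => le0.
apply: leq_trans (leq_add le0 (leqnn _)) _; set T := Theta + _.
have le1 : (\dim (piece Delta T j) <= \dim (piece setT T j)
    + count (fun w => mon m w \notin U) (words m q j))%N.
  rewrite -size_filter; apply: (@piece_le _ _ _ _ _ _ t _
    (fun w => [/\ word q w, size w = j & mon m w \notin U])).
    by move=> w [ww wj wU]; rewrite mem_filter wU mem_words // ww wj eqxx.
  by move=> c cj cD; apply: (nonface_span qm rq jd gen).
apply: leq_trans (leq_add le1 (leqnn _)) _.
have -> : (\dim (piece setT T j) + count (fun w => mon m w \notin U) (words m q j) +
   count (fun w => mon m w \in U) (words m q j) = \dim (piece setT T j) + size (words m q j))%N.
  by rewrite -addnA [X in (_ + X)%N]addnC (count_predC (fun w => mon m w \in U)).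
apply: (dim_piece_setT rq) (uniq_words _ _ _) _ => [|w].
  by apply: gen; rewrite cardsCs setCK card_ord card_initial; lia.
by rewrite mem_words // => /andP[-> /eqP].
Qed.

End HilbertFunction.

(** * Krull dimension *)

Section PrimeChains.
Variables (K : fieldType) (n : nat).
Local Notation S := {mpoly K[n]}.

Section IdealPred.
Variable p : {pred S}.
Hypothesis ip : idealr_closed p.

Lemma idealr_sum (T : finType) (Q : pred T) (F : T -> S) :
  (forall x, Q x -> F x \in p) -> \sum_(x | Q x) F x \in p.
Proof.
case: ip => p0 _ pD Fp; elim/big_ind: _ => // f g fp gp.
by rewrite -[f]mul1r; apply: pD.
Qed.

Lemma idealr_mul f g : g \in p -> f * g \in p.
Proof. by case: ip => p0 _ pD gp; rewrite -[_ * _]addr0; apply: pD. Qed.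

Lemma idealr_scale a g : g \in p -> a *: g \in p.
Proof. by rewrite -mul_mpolyC; apply: idealr_mul. Qed.

Lemma idealr_add f g : f \in p -> g \in p -> f + g \in p.
Proof. by case: ip => p0 _ pD fp gp; rewrite -[f]mul1r; apply: pD. Qed.

Lemma idealr_sub f g : f + g \in p -> g \in p -> f \in p.
Proof.
by move=> fgp gp; rewrite -[f](addrK g) -mulN1r; apply/idealr_add/idealr_mul.
Qed.

Lemma prime_cancel_exp f g k : prime_idealr_closed p ->
  f \notin p -> f ^+ k * g \in p -> g \in p.
Proof.
move=> pp fp; elim: k => [|k IH]; first by rewrite expr0 mul1r.
by rewrite exprS -mulrA => /pp /orP[/(negP fp)//|]; apply: IH.
Qed.

End IdealPred.

(** If f_i lies in p_(i+1) but not in p_i, then the f_i are algebraically independent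
    modulo p_0. Given a relation modulo p_i in f_i, f_(i+1), ..., divide by the lowest
    power of f_i that occurs, as p_i is prime and does not contain f_i; then modulo
    p_(i+1) only the terms with that power survive, and form a relation in f_(i+1),
    .... *)
Lemma chain_independent (p : nat -> {pred S}) k (f : 'I_k -> S) x
    (lam : {ffun 'I_k -> 'I_x} -> K) :
  (forall i, (i <= k)%N -> idealr_closed (p i) /\ prime_idealr_closed (p i)) ->
  (forall i : 'I_k, [/\ {subset p i <= p i.+1}, f i \in p i.+1 & f i \notin p i]) ->
  \sum_b lam b *: \prod_l f l ^+ b l \in p 0%N -> forall b, lam b = 0.
Proof.
move=> ip fp.
suff main h i (Q : pred {ffun 'I_k -> 'I_x}) : (i + h = k)%N ->
    (forall b b', Q b -> Q b' -> forall l : 'I_k, (l < i)%N -> b l = b' l) ->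
    \sum_(b | Q b) lam b *: \prod_(l : 'I_k | (i <= l)%N) f l ^+ b l \in p i ->
    forall b, Q b -> lam b = 0.
  by move=> h b; apply: (main k 0%N predT).
elim: h i Q => [|h IH] i Q ihk eqQ sum_p b Qb.
  have /ip[[_ p1 _] _] : (i <= k)%N by lia.
  apply/eqP; apply: contraNT p1 => lb.
  have Q1 b' : Q b' = (b' == b).
    apply/idP/eqP => [Qb'|->//]; apply/ffunP => l; apply: eqQ => //.
    by have := ltn_ord l; lia.
  move: sum_p; rewrite (big_pred1 b) // big1 => [|l]; last first.
    by have := ltn_ord l; lia.
  have [ip' _] := ip i (leq_trans (leq_addr 0%N i) (eq_leq ihk)).
  by move/(idealr_scale ip' (lam b)^-1); rewrite scalerA mulVf // scale1r.
apply/eqP/negPn/negP => lb.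
have ik : (i < k)%N by lia.
have [ipi pri] := ip i (ltnW ik); have [ipS _] := ip i.+1 ik.
have [subp fin fout] := fp (Ordinal ik); rewrite /= in subp fin fout.
pose R (b : {ffun 'I_k -> 'I_x}) := Q b && (lam b != 0).
have Rb : R b by rewrite /R Qb.
have [b0 /andP[Qb0 lb0] b0min] :=
  arg_minnP (fun b : {ffun 'I_k -> 'I_x} => val (b (Ordinal ik))) Rb.
set v := val (b0 (Ordinal ik)) in b0min.
pose rest (b' : {ffun 'I_k -> 'I_x}) := \prod_(l : 'I_k | (i.+1 <= l)%N) f l ^+ b' l.
have prodE (b' : {ffun 'I_k -> 'I_x}) : \prod_(l : 'I_k | (i <= l)%N) f l ^+ b' l
    = f (Ordinal ik) ^+ b' (Ordinal ik) * rest b'.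
  rewrite (bigD1 (Ordinal ik)) //=; congr (_ * _); apply: eq_bigl => l.
  by rewrite -val_eqE /= [RHS]ltn_neqAle andbC eq_sym.
have sumR : \sum_(b | R b) lam b *: (f (Ordinal ik) ^+ (b (Ordinal ik) - v) * rest b) \in p i.
  apply: (prime_cancel_exp (k := v) pri fout); rewrite mulr_sumr.
  rewrite (bigID (fun b => lam b != 0)) /= [X in _ + X]big1 ?addr0 in sum_p; last first.
    by move=> b' /andP[_ /negPn/eqP ->]; rewrite scale0r.
  rewrite (eq_bigr (fun b => lam b *: \prod_(l : 'I_k | (i <= l)%N) f l ^+ b l)) //.
  by move=> b' Rb'; rewrite prodE -scalerAr mulrA -exprD subnKC // b0min.
have sum0 : \sum_(b | R b && (val (b (Ordinal ik)) == v)) lam b *: rest b \in p i.+1.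
  move: (subp _ sumR);
  rewrite (bigID (fun b : {ffun 'I_k -> 'I_x} => val (b (Ordinal ik)) == v)) /=.
  move/(idealr_sub ipS) => /(_ _) sumv.
  rewrite (eq_bigr (fun b => lam b *: (f (Ordinal ik) ^+ (b (Ordinal ik) - v) * rest b))).
    apply: sumv; apply: idealr_sum => // b' /andP[Rb' b'v]; apply: idealr_scale => //.
    have := b0min b' Rb'; rewrite leq_eqVlt eq_sym (negbTE b'v) /= => vb'.
    rewrite -(prednK (n := b' (Ordinal ik) - v)) ?subn_gt0 // exprSr -mulrA mulrCA.
    by rewrite mulrC; do 2 apply: (idealr_mul ipS) => //; rewrite mulrC; apply: idealr_mul.
  by move=> b' /andP[_ /eqP ->]; rewrite subnn expr0 mul1r.
have eqQ' (b1 b2 : {ffun 'I_k -> 'I_x}) :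
    R b1 && (val (b1 (Ordinal ik)) == v) -> R b2 && (val (b2 (Ordinal ik)) == v) ->
    forall l : 'I_k, (l < i.+1)%N -> b1 l = b2 l.
  move=> /andP[/andP[Q1 _] /eqP e1] /andP[/andP[Q2 _] /eqP e2] l.
  rewrite ltnS leq_eqVlt => /predU1P[li|]; last exact: eqQ.
  have -> : l = Ordinal ik by apply: val_inj.
  by apply: val_inj; rewrite e1 e2.
have Rb0 : R b0 && (val (b0 (Ordinal ik)) == v) by rewrite /R Qb0 lb0 eqxx.
have hk : (i.+1 + h = k)%N by rewrite addSnnS.
by have := IH i.+1 _ hk eqQ' sum0 b0 Rb0; apply/eqP.
Qed.

(** A crude bound is enough, since it only enters a constant in [prime_chain_le]. *)
Lemma msize_prod_le (T : Type) (s : seq T) (F : T -> S) c :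
  (forall x, (msize (F x) <= c)%N) ->
  (msize (\prod_(x <- s) F x)%R <= size s * c.+1 + 1)%N.
Proof.
move=> Fc; elim: s => [|x s IH]; first by rewrite big_nil mmeasureC oner_neq0.
rewrite big_cons; apply: leq_trans (msizeM_le _ _) _.
by have := Fc x; rewrite /= mulSn; move: IH; set a := msize _; set b := msize _; lia.
Qed.

End PrimeChains.

Section KrullDim.
Variables (K : fieldType) (N' : nat).
Local Notation N := N'.+1.
Local Notation S := {mpoly K[N]}.
Variables (Delta : {set {set 'I_N}}) (e : nat).
Hypothesis face_small : forall A, A \in Delta -> (#|A| <= e)%N.

Lemma stanley_reisner_coef (f : S) :
  (forall c, msupport c \in Delta -> f@_c = 0) -> (@stanley_reisner K _ Delta) f.
Proof.
move=> f0; rewrite [f]mpolyE.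
have iJ : is_ideal (@stanley_reisner K _ Delta) by apply: ideal_gen_ideal.
apply: (ideal_sum iJ) => c; rewrite mcoeff_msupp => fc.
rewrite -mul_mpolyC; apply: (idealM _ iJ).
apply: (monomial_nonface _ (subxx _)); apply: contra fc => /f0 ->; exact: eqxx.
Qed.

(** A monomial is determined by its support and the exponents there. *)
Lemma card_face_monomials D :
  (#|[set c : 'X_{1..N < D.+1} | msupport c \in Delta]| <= 2 ^ N * D.+1 ^ e)%N.
Proof.
pose h (c : 'X_{1..N < D.+1}) : {set 'I_N} * {ffun 'I_e -> 'I_D.+1} :=
  (msupport c, [ffun i : 'I_e => inord (oapp c 0%N (onth (enum (msupport c)) i))]).
rewrite -(card_in_imset (f := h)) => [|c c' cD c'D [es /ffunP ef]].
  apply: leq_trans (max_card _) _.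
  rewrite card_prod card_ffun !card_ord -[X in (X * _)%N]cardsT -powersetT.
  by rewrite card_powerset cardsT card_ord.
rewrite !inE in cD c'D; apply: val_inj; apply/mnmP => v.
have [vc|] := boolP (v \in msupport c); last first.
  by move=> vc; move: (vc); rewrite es; move: vc; rewrite !inE !negbK => /eqP -> /eqP ->.
have ive : (index v (enum (msupport c)) < e)%N.
  apply: leq_trans (face_small cD); rewrite cardE index_mem mem_enum //.
have on (A : {set 'I_N}) : v \in A -> onth (enum A) (index v (enum A)) = Some v.
  move=> vA; have iA : (index v (enum A) < size (enum A))%N by rewrite index_mem mem_enum.
  by rewrite onthE (nth_map v) // nth_index // mem_enum.
have := ef (Ordinal ive); rewrite !ffunE /= -es on //= => /(congr1 (@nat_of_ord _)).
rewrite !inordK //.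
  by apply: leq_ltn_trans (bmdeg c'); rewrite mdegE (bigD1 v) //= leq_addr.
by apply: leq_ltn_trans (bmdeg c); rewrite mdegE (bigD1 v) //= leq_addr.
Qed.

(** The x^(e+1) monomials in e + 1 elements that climb the chain, with exponents below
    x, would be independent modulo the Stanley-Reisner ideal. But modulo this ideal
    they live in the span of the monomials with face support of degree at most D =
    x c0, of which there are only O(x^e). *)
Lemma prime_chain_le k p :
  prime_chain (@stanley_reisner K _ Delta) k p -> (k <= e)%N.
Proof.
move=> [pP pS]; rewrite leqNgt; apply/negP => ek.
have /fin_all_exists[f fP] : forall i : 'I_e.+1,
    exists f : S, [/\ {subset p i <= p i.+1}, f \in p i.+1 & f \notin p i].
  move=> i; have [sub [f fin fout]] := pS i (leq_trans (ltn_ord i) ek).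
  by exists f.
pose M := (\max_i msize (f i))%N.
have fM i : (msize (f i) <= M)%N by apply: (leq_bigmax i).
pose c0 := (e.+1 * (M + 3) + 1)%N.
(* Chosen such that 2^N (x (c0 + 1))^e < x^(e+1). *)
pose x := (2 ^ N * c0.+1 ^ e).+1.
pose D := (x * c0)%N.
pose B := {ffun 'I_e.+1 -> 'I_x}.
pose g (b : B) : S := \prod_l f l ^+ b l.
have gD b : (msize (g b) <= D)%N.
  have := @msize_prod_le K N _ (enum 'I_e.+1) (fun l => f l ^+ b l) (x * M.+1 + 1).
  rewrite big_enum /= size_enum_ord => /(_ _)/leq_trans; apply=> [l|]; last first.
    by rewrite /D /c0; have : (0 < x)%N by []; nia.
  have := @msize_prod_le K N _ (nseq (b l) tt) (fun=> f l) M.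
  rewrite big_nseq iter_mulr_1 size_nseq => /(_ (fun=> fM l))/leq_trans; apply.
  by rewrite leq_add2r leq_mul2r ltnW ?orbT.
pose CT := {c : 'X_{1..N < D.+1} | msupport c \in Delta}.
pose A : 'M[K]_(#|{: B}|, #|{: CT}|) :=
  \matrix_(i, k) (g (enum_val i))@_(val (val (enum_val k))).
have cardBC : (#|{: CT}| < #|{: B}|)%N.
  rewrite card_ffun !card_ord card_sig.
  have := card_face_monomials D; rewrite cardsE => /leq_ltn_trans; apply.
  have Dx : (D.+1 <= x * c0.+1)%N by rewrite /D mulnS -add1n leq_add2r.
  have Dxe : (D.+1 ^ e <= (x * c0.+1) ^ e)%N.
    by case: (posnP e) => [->//|e0]; rewrite leq_exp2r.
  apply: leq_ltn_trans (leq_mul (leqnn _) Dxe) _.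
  rewrite expnMn [(x ^ _.+1)%N]expnSr mulnCA ltn_pmul2l ?expn_gt0 //.
have /rowV0Pn[lam /sub_kermxP lamA lam0] : kermx A != 0.
  rewrite kermx_eq0 /row_free neq_ltn (leq_ltn_trans (rank_leq_col A)) //.
have sum_p : \sum_b lam 0 (enum_rank b) *: g b \in p 0%N.
  have [_ _] := pP 0%N (leq0n _); apply; apply: stanley_reisner_coef => c cD.
  rewrite raddf_sum /=.
  have [cs|cs] := ltnP (mdeg c) D.+1; last first.
    rewrite big1 // => b _; rewrite mcoeffZ memN_msupp_eq0 ?mulr0 //.
    by apply: msize_mdeg_ge; apply: leq_trans (gD b) (ltnW cs).
  pose c1 : CT := exist _ (BMultinom cs) cD.
  have /matrixP/(_ 0 (enum_rank c1)) := lamA; rewrite [X in X = _]mxE [X in _ = X]mxE => lamA1.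
  rewrite -[RHS]lamA1.
  rewrite (reindex (@enum_val B predT)) /=; last first.
    by exists enum_rank => ? _; rewrite ?enum_valK ?enum_rankK.
  by apply: eq_bigr => i _; rewrite mcoeffZ enum_valK mxE enum_rankK.
have lamE : lam = 0.
  apply/rowP => i; rewrite mxE -(enum_valK i).
  apply: (chain_independent (p := p) (f := f) (lam := fun b => lam 0 (enum_rank b))).
  - by move=> j je; have [|ij pj _] := pP j; first exact: leq_trans ek.
  - exact: fP.
  - exact: sum_p.
by rewrite lamE eqxx in lam0.
Qed.

Hypothesis Delta_down : down_closed Delta.

(** Set the variables off the facet to 0, and then those of the facet one by one. *)
Lemma prime_chain_ex A : A \in Delta -> #|A| = e ->
  exists p, prime_chain (@stanley_reisner K _ Delta) e p.
Proof.
move=> AD Ae; pose G k : {set 'I_N} := [set v in drop k (enum A)].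
pose ev k (f : S) : S := f \mPo [tuple if v \in G k then 'X_v else 0 | v < N].
have evX k (v : 'I_N) : ev k 'X_v = if v \in G k then 'X_v else 0.
  by rewrite /ev comp_mpolyXU -tnth_nth tnth_mktuple.
have evS k f : ev k.+1 (ev k f) = ev k.+1 f.
  have evD i g h : ev i (g + h) = ev i g + ev i h by rewrite /ev linearD.
  elim/mpoly_linear_ind: f => [|f g hf hg|a c]; first by rewrite /ev !linear0.
    by rewrite !evD hf hg.
  have evZ i b g : ev i (b *: g) = b *: ev i g by rewrite /ev linearZ.
  rewrite !evZ; congr (_ *: _); rewrite mpolyXE_id.
  have evP i (F : 'I_N -> S) : ev i (\prod_v F v) = \prod_v ev i (F v).
    by rewrite /ev rmorph_prod.
  have evE i g h : ev i (g ^+ h) = ev i g ^+ h by rewrite /ev rmorphXn.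
  rewrite !evP; apply: eq_bigr => v _; rewrite !evE !evX; congr (_ ^+ _).
  case: ifP => vk; rewrite ?evX //; have -> : v \in G k.+1 = false.
    apply: contraFF vk; rewrite !inE -[k.+1]add1n -drop_drop; exact: mem_drop.
  by rewrite /ev linear0.
pose p k : {pred S} := fun f => ev k f == 0; exists p.
have inp k f : (f \in p k) = (ev k f == 0) by [].
split=> [i ie|i ie].
  split.
  - split=> [||a f g]; rewrite !inp /ev ?linear0 ?rmorph1 ?oner_neq0 //.
    by move=> /eqP f0 /eqP g0; rewrite rmorphD rmorphM /= f0 g0 mulr0 addr0.
  - by move=> f g; rewrite !inp /ev rmorphM mulf_eq0.
  apply: ideal_gen_sub => [|_ [B BD ->]].
    split=> [|f g|f g]; rewrite !inp /ev ?linear0 //.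
      by move=> /eqP f0 /eqP g0; rewrite rmorphD /= f0 g0 addr0.
    by move=> /eqP g0; rewrite rmorphM /= g0 mulr0.
  have /subsetPn[v vB vA] : ~~ (B \subset A).
    by apply: contra BD => BA; apply: Delta_down BA AD.
  rewrite inp /ev rmorph_prod (bigD1 v) //= -/(ev _ _) evX ifF ?mul0r //.
  by apply: contraNF vA; rewrite inE => /mem_drop; rewrite mem_enum.
have size_A : size (enum A) = e by rewrite -cardE.
split=> [f|]; first by rewrite !inp -evS => /eqP ->; rewrite /ev linear0.
have [v0 _] : exists v : 'I_N, true by exists ord0.
have dE := drop_nth v0 (_ : (i < size (enum A))%N).
exists 'X_(nth v0 (enum A) i); rewrite inp evX inE.
  rewrite ifF //; have := drop_uniq i (enum_uniq A).
  by rewrite dE ?size_A //= => /andP[/negbTE].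
rewrite dE ?size_A // mem_head.
by rewrite -msupp_eq0 msuppX.
Qed.

End KrullDim.

(** * Linear systems of parameters and multiplication maps *)

(** For [f] the multiplication by a linear form and [P] the part of an ideal, this
    relates the cokernel of [f] modulo [P] to its kernel. *)
Lemma dim_add_limg (K : fieldType) (aT rT : vectType K) (f : 'Hom(aT, rT))
    (P : {vspace rT}) :
  (\dim (P + limg f) + \dim (f @^-1: P) = \dim P + \dim (fullv : {vspace aT}))%N.
Proof.
have pre := limg_ker_dim f (f @^-1: P); have full := limg_ker_dim f fullv.
have cap := dimv_sum_cap P (limg f).
have ker : (f @^-1: P :&: lker f = lker f)%VS.
  by apply/capv_idPr; rewrite -lpreim0 lpreimS // sub0v.
have im : (f @: (f @^-1: P) = P :&: limg f)%VS.
  by rewrite -lpreim_cap_limg lpreimK // capvSr.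
rewrite capfv in full; rewrite ker im in pre.
move: pre full cap; lia.
Qed.

Section LinearParameters.
Variables (K : fieldType) (N' : nat).
Local Notation N := N'.+1.
Local Notation S := {mpoly K[N]}.
Variable Delta : {set {set 'I_N}}.
Hypothesis Delta_down : down_closed Delta.

(** If the forms had a common zero p supported on the face F, then the whole ideal
    would vanish on the line through p, and restriction to this line would map the
    quotient onto a polynomial ring in one variable. *)
Lemma finite_dim_spans_off r (Theta : 'M[K]_(r, N)) (F : {set 'I_N}) :
  finite_dim_quot (linear_quotient_ideal Delta Theta) -> F \in Delta ->
  spans_off Theta (~: F).
Proof.
move=> [b bP] FD; apply: spans_offP => p pF Tp; apply/eqP/negPn/negP => p0.
have [v pv] : exists v, p v 0 != 0.
  apply/existsP; apply: contraNT p0 => /existsPn h; apply/eqP/matrixP => v i.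
  by rewrite ord1 mxE; apply/eqP/negPn/h.
pose h (v : 'I_N) : {poly K} := p v 0 *: 'X.
pose ev (f : S) : {poly K} := mmap polyC h f.
have evX (u : 'I_N) : ev 'X_u = p u 0 *: 'X by rewrite /ev mmapX mmap1U.
have evJ f : linear_quotient_ideal Delta Theta f -> ev f = 0.
  have iE : is_ideal (fun f => ev f = 0).
    split=> [|f1 f2 e1 e2|f1 f2 e2]; first by rewrite /ev raddf0.
      by rewrite /ev rmorphD /= -/(ev _) e1 -/(ev _) e2 addr0.
    by rewrite /ev rmorphM /= -!/(ev _) e2 mulr0.
  apply: (ideal_gen_sub iE) => {}f [|[i ->]].
    apply: (ideal_gen_sub iE) => _ [A AD ->].
    have /subsetPn[u uA uF] : ~~ (A \subset F).
      by apply: contra AD => AF; apply: Delta_down AF FD.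
    rewrite /ev rmorph_prod (bigD1 u) //= -/(ev _) evX pF ?inE //.
    by rewrite scale0r mul0r.
  rewrite /linform /ev raddf_sum /=.
  rewrite (eq_bigr (fun u => (Theta i u * p u 0) *: 'X)).
    have /matrixP/(_ i 0) := Tp; rewrite !mxE => Ti.
    by rewrite -scaler_suml Ti scale0r.
  by move=> u _; rewrite mmapZ -/(ev _) evX mul_polyC scalerA mxE.
pose M := (\max_(i < size b) size (ev (nth 0%R b i)))%N.
have [c /evJ] := bP ('X_v ^+ M); set g := \sum_(i < _) _.
have evg : ev g = \sum_(i < size b) c i *: ev b`_i.
  have evD : {morph ev : f1 f2 / f1 + f2} by move=> f1 f2; rewrite /ev raddfD.
  rewrite /g (big_morph ev evD (raddf0 _)); apply: eq_bigr => i _.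
  by rewrite /ev mmapZ mul_polyC.
rewrite /ev rmorphB rmorphXn /= -!/(ev _) evX evg => /eqP.
rewrite subr_eq0 => /eqP /(congr1 (fun q : {poly K} => size q)) e.
suff : (M.+1 <= M)%N by rewrite ltnn.
rewrite -{1}(size_polyXn K M) -(size_scale 'X^M (expf_neq0 M pv)) -exprZn e.
apply: leq_trans (size_sum _ _ _) _; apply/bigmax_leqP => i _.
apply: leq_trans (size_scale_leq _ _) _.
exact: (leq_bigmax (F := fun i : 'I_(size b) => size (ev b`_i))).
Qed.

(** If the ideal is everything in large degrees, then the monomials of small degree
    span the quotient. *)
Lemma finite_dim_of_pieces r (Theta : 'M[K]_(r, N)) d :
  (forall j, (d < j)%N -> (\dim (fullv : {vspace dhomog N K j}) <=
     \dim (piece Delta Theta j))%N) ->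
  finite_dim_quot (linear_quotient_ideal Delta Theta).
Proof.
move=> full; have iJ := linear_quotient_is_ideal Delta Theta.
exists [seq 'X_[val c] | c : 'X_{1..N < d.+1}] => f.
have c0lt : (mdeg (0%MM : 'X_{1..N}) < d.+1)%N by rewrite mdeg0.
pose c0 := BMultinom c0lt; pose e := enum {: 'X_{1..N < d.+1}}.
exists (fun i => oapp (fun c : 'X_{1..N < d.+1} => f@_(val c)) 0 (onth e i)).
rewrite size_map -/e.
have -> : \sum_(i < size e) oapp (fun c : 'X_{1..N < d.+1} => f@_(val c)) 0 (onth e i)
    *: [seq 'X_[val c] | c : 'X_{1..N < d.+1}]`_i
    = \sum_(c : 'X_{1..N < d.+1}) f@_(val c) *: 'X_[val c] :> S.
  transitivity (\sum_(c <- e) f@_(val c) *: 'X_[val c] : S); last by rewrite big_enum.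
  rewrite (big_nth c0) big_mkord; apply: eq_bigr => i _.
  by rewrite (nth_map c0) // onthE (nth_map c0).
set g := f - _; rewrite [g]mpolyE; apply: (ideal_sum iJ) => c.
rewrite mcoeff_msupp => gc; rewrite -mul_mpolyC; apply: (idealM _ iJ).
have [cd|dc] := leqP (mdeg c) d.
  case/negP: gc; rewrite /g mcoeffB raddf_sum /=.
  have cd' : (mdeg c < d.+1)%N by [].
  rewrite (bigD1 (BMultinom cd')) //= big1 => [|c' c'c].
    by rewrite addr0 mcoeffZ mcoeffX eqxx mulr1 subrr.
  rewrite mcoeffZ mcoeffX; case: eqP => [ec|]; last by rewrite mulr0.
  by case/eqP: c'c; apply: val_inj.
have hX : ('X_[c] : S) \is (mdeg c).-homog by rewrite dhomogX.
rewrite -(hpart_homog hX); apply: piece_ideal.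
have /eqP -> : piece Delta Theta (mdeg c) == fullv by rewrite eqEdim subvf full.
exact: memvf.
Qed.

Section Multiplication.
Variables (r : nat) (Theta : 'M[K]_(r, N)) (x : 'rV[K]_N) (i : nat).
Local Notation l := (linform x).
Local Notation J := (linear_quotient_ideal Delta Theta).
Local Notation J' := (linear_quotient_ideal Delta (col_mx Theta x)).

Definition mul_form_fun (v : dhomog N K i) : dhomog N K i.+1 := hpart i.+1 (l * val v).

Lemma mul_form_is_linear : linear mul_form_fun.
Proof. by move=> a u v; rewrite /mul_form_fun /= mulrDr -scalerAr linearP. Qed.
HB.instance Definition _ := GRing.isLinear.Build K _ _ _ mul_form_fun mul_form_is_linear.

Definition mul_form : 'Hom(dhomog N K i, dhomog N K i.+1) := linfun mul_form_fun.

Lemma val_mul_form v : val (mul_form v) = l * val v.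
Proof.
have -> : mul_form v = mul_form_fun v by rewrite /mul_form lfunE.
rewrite hpart_homog //.
by have := dhomogM (linform_homog x) (dhomog_is_dhomog v); rewrite add1n.
Qed.

Lemma ideal_col_mx f : J f -> J' f.
Proof.
apply: ideal_gen_sub => [|{}f [Jf|[k ->]]]; first exact: ideal_gen_ideal.
  by apply: ideal_gen_mem; left.
by apply: ideal_gen_mem; right; exists (lshift 1 k); rewrite rowKu.
Qed.

Lemma ideal_col_mx_last : J' l.
Proof.
apply: ideal_gen_mem; right; exists (rshift r ord0); rewrite rowKd; congr linform.
by apply/rowP => k; rewrite mxE.
Qed.

Lemma piece_col_mx :
  piece Delta (col_mx Theta x) i.+1 = (piece Delta Theta i.+1 + limg mul_form)%VS.
Proof.
have iJ := linear_quotient_is_ideal Delta (col_mx Theta x).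
have iJ0 := linear_quotient_is_ideal Delta Theta.
apply/eqP; rewrite eqEsubv; apply/andP; split.
  apply/span_subvP => _ /mapP[y _ ->]; case: y => [c|[c k]] /=.
    case: ifP => [_|/negbT cD]; first exact: mem0v.
    apply: (subvP (addvSl _ _)); apply: mem_piece => //.
    exact: linear_quotient_nonface (subxx _) cD.
  rewrite -(splitK k); case: (split k) => k' /=.
    rewrite rowKu; apply: (subvP (addvSl _ _)); apply: mem_piece => //.
    by apply: (idealM _ iJ0); apply: linear_quotient_form.
  rewrite rowKd; have -> : row k' x = x by apply/rowP => z; rewrite mxE ord1.
  apply: (subvP (addvSr _ _)); apply/memv_imgP; exists (hpart i 'X_[c]); rewrite ?memvf //.
  apply: val_inj; rewrite val_mul_form /=.
  have hX : ('X_[c] : S) \is (mdeg c).-homog by rewrite dhomogX.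
  have [ci|ci] := eqVneq (mdeg c) i.
    have hXl := monomial_form_homog c x.
    move: (bmnm c) ci hX hXl => c' <- hX hXl.
    by rewrite !pihomog_dE // mulrC.
  rewrite [pihomog mdeg i _](pihomog_ne0 ci hX) mulr0.
  by rewrite (pihomog_ne0 _ (monomial_form_homog c x)).
apply/subvP => _ /memv_addP[u uP [_ /memv_imgP[w _ ->] ->]].
apply: memvD.
  by apply/piece_val => //; apply: ideal_col_mx; apply: piece_ideal.
apply/piece_val => //; rewrite val_mul_form mulrC; apply: (idealM _ iJ).
exact: ideal_col_mx_last.
Qed.

Lemma mul_injectiveE :
  mul_injective J l i <-> (mul_form @^-1: piece Delta Theta i.+1 <= piece Delta Theta i)%VS.
Proof.
split=> [inj|sub f hf Jlf].
  apply/subvP => v; rewrite -memv_preim => /piece_ideal; rewrite val_mul_form => Jlv.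
  by apply/piece_val => //; apply: inj => //; apply: dhomog_is_dhomog.
rewrite -(hpart_homog hf); apply: piece_ideal; apply: (subvP sub).
rewrite -memv_preim; apply/piece_val => //; rewrite val_mul_form hpart_homog //.
Qed.

Lemma mul_surjectiveE :
  mul_surjective J l i <-> piece Delta (col_mx Theta x) i.+1 = fullv.
Proof.
rewrite piece_col_mx; split=> [surj|full g hg].
  apply/eqP; rewrite eqEsubv subvf; apply/subvP => v _.
  have [|f hf Jf] := surj (val v); first exact: dhomog_is_dhomog.
  rewrite -[v]hpart_val -[val v](subrK (l * f)) linearD; apply: memv_add.
    exact: mem_piece.
  apply/memv_imgP; exists (hpart i f); rewrite ?memvf //; apply: val_inj.
  rewrite val_mul_form !hpart_homog //.
  by have := dhomogM (linform_homog x) hf; rewrite add1n.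
have : hpart i.+1 g \in (piece Delta Theta i.+1 + limg mul_form)%VS by rewrite full memvf.
move=> /memv_addP[u uP [_ /memv_imgP[w _ ->] e]].
exists (val w); first exact: dhomog_is_dhomog.
have -> : g - l * val w = val u.
  by rewrite -(hpart_homog hg) e /= -val_mul_form addrK.
exact: piece_ideal.
Qed.

End Multiplication.

End LinearParameters.

(** * The weak Lefschetz property as a numerical condition *)

Lemma dim_count_inj p' pre p1 s0 p0 s1 c1 h0 h1 :
  (p' + pre = p1 + s0 -> p' + c1 <= s1 -> pre <= p0 -> p0 + h0 = s0 ->
   p1 + h1 = s1 -> c1 + h0 <= h1)%N.
Proof. by move=> e1 l1 l2 e2 e3; lia. Qed.

Lemma dim_count_mul p' pre p1 s0 p0 s1 c1 h0 h1 :
  (p' + pre = p1 + s0 -> s1 <= p' + c1 -> c1 + h0 <= h1 -> p0 + h0 = s0 ->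
   p1 + h1 = s1 -> pre <= p0)%N.
Proof. by move=> e1 l1 l2 e2 e3; lia. Qed.

Section Lefschetz.
Variables (K : fieldType) (n : nat) (U : {fset 'X_{1..n.+1}}) (t N' : nat).
Local Notation N := N'.+1.
Local Notation S := {mpoly K[N]}.
Local Notation d := (dmax U).
Variable Delta : {set {set 'I_N}}.
Hypotheses (U_ideal : order_ideal U) (U_shifted : shifted U).
Hypothesis N_def : N = (n.+1 + t + d)%N.
Hypothesis Delta_def :
  Delta = [set A : {set 'I_N} | [exists u : U, A \subset ~: gaps t N n.+1 (word_of (val u))]].
Hypothesis K_infinite : forall s : seq K, exists x : K, x \notin s.

Local Notation h := (hilb U n.+1).
Local Notation c := (hilb U n).

Let Delta_down := Delta_down Delta_def.
Let hupper := hilb_upper (K := K) U_ideal U_shifted Delta_def.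
Let hlower := hilb_lower (K := K) U_ideal U_shifted N_def Delta_def K_infinite.

Lemma card_gaps_in q u : (q <= n.+1)%N -> u \in U ->
  #|gaps t N q (word_of u)| = q.
Proof.
move=> qm uU; apply: card_gaps; apply: leq_trans (size_word_dmax N_def uU).
by rewrite leq_add2r.
Qed.

Lemma krull_dim_Delta : krull_dim (@stanley_reisner K _ Delta) (d + t).
Proof.
have cardF u : u \in U -> #|~: gaps t N n.+1 (word_of u)| = (d + t)%N.
  by move=> uU; rewrite cardsCs setCK card_ord card_gaps_in // N_def; lia.
split; last first.
  move=> k p; apply: prime_chain_le => A /(DeltaP Delta_def)[u uU].
  by move=> /subset_leq_card; rewrite cardF.
have [_ U0 _] := U_ideal.
apply: (prime_chain_ex K Delta_down (A := ~: gaps t N n.+1 (word_of 0%MM))).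
  by apply/(DeltaP Delta_def); exists 0%MM.
exact: cardF.
Qed.

(** For parameters, both bounds hold with q = m, so the Hilbert function of the
    quotient is h. *)
Lemma lefschetz_step e (Theta : 'M[K]_(e, N)) (x : 'rV[K]_N) i :
  e = (d + t)%N -> finite_dim_quot (linear_quotient_ideal Delta Theta) ->
  (\dim (piece Delta (col_mx Theta x) i.+1) + \dim (mul_form x i @^-1: piece Delta Theta i.+1)
    = \dim (piece Delta Theta i.+1) + \dim (fullv : {vspace dhomog N K i}))%N /\
  forall j, (\dim (piece Delta Theta j) + h j)%N = \dim (fullv : {vspace dhomog N K j}).
Proof.
move=> ee fin; split; first by rewrite piece_col_mx // dim_add_limg.
move=> j; apply/eqP; rewrite eqn_leq hlower //; last by rewrite N_def ee; lia.
apply: hupper => // u uU _; rewrite -[gaps _ _ _ _]setCK.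
by apply: (finite_dim_spans_off Delta_down fin); apply/(DeltaP Delta_def); exists u.
Qed.

(** If multiplication by l from degree i is surjective then the quotient by l vanishes
    in degree i + 1, and if it is injective then the quotient has dimension h_(i+1) -
    h_i; this dimension is at least c_(i+1). *)
Lemma hilb_of_lefschetz : weak_lefschetz (@stanley_reisner K _ Delta) ->
  forall i, c i.+1 = 0%N \/ (c i.+1 + h i <= h i.+1)%N.
Proof.
move=> [e [theta [l [[[[p pc] kmax] hth fin] hl wl]]]] i.
have [[p' pc'] kmax'] := krull_dim_Delta.
have ee : e = (d + t)%N by apply/eqP; rewrite eqn_leq (kmax' _ _ pc) (kmax _ _ pc').
pose Theta : 'M[K]_(e, N) := \matrix_(i, v) (theta i)@_U_(v).
pose x : 'rV[K]_N := \row_v l@_U_(v).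
have lE : l = linform x by apply: homog1_linform.
have JE : ideal_add (@stanley_reisner K _ Delta) theta = linear_quotient_ideal Delta Theta.
  rewrite /linear_quotient_ideal; congr ideal_add; apply: functional_extensionality => k.
  rewrite {1}[theta k]homog1_linform //; congr linform.
  by apply/rowP => v; rewrite !mxE.
rewrite JE lE in fin wl.
have [dim_mul dim_h] := lefschetz_step x i ee fin.
have low : (\dim (piece Delta (col_mx Theta x) i.+1) + c i.+1
    <= \dim (fullv : {vspace dhomog N K i.+1}))%N.
  by apply: hlower => //; rewrite N_def ee; lia.
case: (wl i) => [/(mul_injectiveE Delta_down)/dimvS inj|/(mul_surjectiveE Delta_down) surj].
  by right; apply: dim_count_inj dim_mul low inj (dim_h i) (dim_h i.+1).
left; rewrite surj in low; apply/eqP; rewrite -leqn0.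
by rewrite -(leq_add2l (\dim (fullv : {vspace dhomog N K i.+1}))) addn0.
Qed.

(** With Vandermonde coefficients, any e of the columns of the parameters, and any e +
    1 of those of the parameters together with l, are independent; so the quotient by
    l has dimension at most c_(i+1) in degree i + 1. By the hypothesis this leaves no
    room for a cokernel or no room for a kernel. *)
Lemma lefschetz_of_hilb :
  (forall i, c i.+1 = 0%N \/ (c i.+1 + h i <= h i.+1)%N) ->
  weak_lefschetz (@stanley_reisner K _ Delta).
Proof.
move=> ch; have [a aI] := distinct_elements K_infinite N.
pose e := (d + t)%N; pose Theta : 'M[K]_(e, N) := \matrix_(i, v) a v ^+ i.
pose x : 'rV[K]_N := \row_v a v ^+ e.
have sT u : u \in U -> spans_off Theta (gaps t N n.+1 (word_of u)).
  move=> uU; apply: (vandermonde_spans_off (s := e) aI) => [k ke|].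
    by exists (Ordinal ke) => v; rewrite mxE.
  by rewrite cardsCs setCK card_ord card_gaps_in // N_def /e; lia.
have sT' u : u \in U -> spans_off (col_mx Theta x) (gaps t N n (word_of u)).
  move=> uU; apply: (vandermonde_spans_off (s := e.+1) aI) => [k ke|].
    move: ke; rewrite ltnS leq_eqVlt => /predU1P[->|ke].
      by exists (rshift e ord0) => v; rewrite col_mxEd mxE.
    by exists (lshift 1 (Ordinal ke)) => v; rewrite col_mxEu mxE.
  by rewrite cardsCs setCK card_ord card_gaps_in // N_def /e; lia.
have fin : finite_dim_quot (linear_quotient_ideal Delta Theta).
  apply: (finite_dim_of_pieces (d := d)) => j dj.
  have -> : \dim (piece Delta Theta j) = (\dim (piece Delta Theta j) + h j)%N.
    by rewrite hilb_gt_dmax // addn0.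
  by apply: hupper => // u uU _; apply: sT.
exists e, (fun i => linform (row i Theta)), (linform x); split.
- split=> //; first exact: krull_dim_Delta.
  by move=> i; apply: linform_homog.
- exact: linform_homog.
move=> i; have [dim_mul dim_h] := lefschetz_step x i (erefl e) fin.
have up : (\dim (fullv : {vspace dhomog N K i.+1})
    <= \dim (piece Delta (col_mx Theta x) i.+1) + c i.+1)%N.
  by apply: hupper => // u uU _; apply: sT'.
case: (ch i) => [c0|ci]; [right|left].
  apply/(mul_surjectiveE Delta_down)/eqP; rewrite eqEdim subvf /=.
  by rewrite c0 addn0 in up.
apply/(mul_injectiveE Delta_down).
have sub : (piece Delta Theta i <= mul_form x i @^-1: piece Delta Theta i.+1)%VS.
  apply/subvP => v vP; rewrite -memv_preim; apply/piece_val => //.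
  rewrite val_mul_form; apply: idealM; first exact: linear_quotient_is_ideal.
  exact: piece_ideal.
suff /eqP <- : piece Delta Theta i == (mul_form x i @^-1: piece Delta Theta i.+1)%VS by [].
by rewrite eqEdim sub /=; apply: dim_count_mul dim_mul up ci (dim_h i) (dim_h i.+1).
Qed.

End Lefschetz.

(** * Order ideals with the numerical condition *)

Section Combinatorics.
Variables (n : nat) (U G : {fset 'X_{1..n.+1}}).
Hypotheses (U_ideal : order_ideal U) (U_shifted : shifted U).
Local Notation h := (hilb U n.+1).
Local Notation c := (hilb U n).
Local Notation xm := (U_(ord_max))%MM.

Lemma word_last (u : 'X_{1..n.+1}) : word n (word_of u) = ~~ (xm <= u)%MM.
Proof.
rewrite lep1mP -mem_word_of /word; have /andP[-> /allP wu] := word_of_word u.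
apply/allP/idP => [wn|nw a aw].
  by apply/negP => /wn /=; rewrite ltnn.
have := wu a aw; rewrite ltnS leq_eqVlt => /predU1P[an|//].
by rewrite an in aw; case/negP: nw.
Qed.

Lemma hilbE j : h j = count (fun u => mdeg u == j) U.
Proof. by apply: eq_count => u; rewrite word_of_word andbT. Qed.

Lemma mem_degree_part j (u : 'X_{1..n.+1}) V :
  (u \in degree_part V j) = (u \in V) && (mdeg u == j).
Proof. by rewrite !inE. Qed.

Lemma hilb_last0 j :
  c j = 0%N <-> (forall u, u \in degree_part U j -> (xm <= u)%MM).
Proof.
split=> [c0 u|div].
  rewrite mem_degree_part => /andP[uU uj]; apply/negPn/negP => nd.
  suff : (0 < c j)%N by rewrite c0.
  by rewrite -has_count; apply/hasP; exists u; rewrite ?uj ?word_last.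
apply/eqP; rewrite -leqn0 leqNgt -has_count; apply/hasPn => u uU.
rewrite word_last negb_and negbK; case: eqP => //= uj.
by apply: div; rewrite mem_degree_part uU uj eqxx.
Qed.

(** Division by x_m maps the monomials of degree i + 1 divisible by x_m injectively to
    those of degree i; c_(i+1) counts the others. *)
Lemma hilb_growth_step i :
  (h i.+1 <= c i.+1 + h i)%N /\
  ((c i.+1 + h i <= h i.+1)%N <->
   (forall u, u \in degree_part U i -> (xm + u)%MM \in degree_part U i.+1)).
Proof.
pose A := [seq u <- U | mdeg u == i].
pose B := [seq u <- U | (mdeg u == i.+1) && (xm <= u)%MM].
have hA : h i = size A by rewrite hilbE size_filter.
have hB : h i.+1 = (c i.+1 + size B)%N.
  rewrite hilbE size_filter -(count_predUI _ _ U) addnC.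
  rewrite (@eq_count _ (predI _ _) pred0) ?count_pred0 => [|u /=]; last first.
    by rewrite word_last; case: (_ <= _)%MM; rewrite ?andbF.
  by apply: eq_count => u /=; rewrite word_last; case: (_ <= _)%MM; rewrite ?andbF ?andbT ?orbF.
have uA : uniq A by rewrite filter_uniq ?fset_uniq.
have uB : uniq B by rewrite filter_uniq ?fset_uniq.
have inA u : (u \in A) = (u \in degree_part U i).
  by rewrite mem_filter mem_degree_part andbC.
have inB u : (u \in B) = (u \in degree_part U i.+1) && (xm <= u)%MM.
  by rewrite mem_filter mem_degree_part andbC -andbA.
pose B' := [seq (u - xm)%MM | u <- B].
have uB' : uniq B'.
  rewrite map_inj_in_uniq // => v w; rewrite !inB => /andP[_ xv] /andP[_ xw] e.
  by rewrite -(submK xv) e submK.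
have sub : {subset B' <= A}.
  move=> _ /mapP[v + ->]; rewrite inB inA !mem_degree_part => /andP[/andP[vU /eqP vi] xv].
  have [Ucl _ _] := U_ideal; rewrite (Ucl _ _ vU (lem_subr _ _)) /=.
  by move: vi; rewrite -{1}(submK xv) mdegD mdeg1 addn1 => -[->].
rewrite hB hA !leq_add2l; split; first by have := uniq_leq_size uB' sub; rewrite size_map.
split=> [AB u uA'|mulU].
  have sz : (size A <= size B')%N by rewrite size_map.
  have [_ eqAB] := uniq_min_size uB' sub sz.
  have : u \in B' by rewrite eqAB inA.
  case/mapP => v; rewrite inB => /andP[vU xv] ->.
  by rewrite addmC submK.
rewrite -(size_map (fun u => xm + u)%MM A); apply: uniq_leq_size.
  by rewrite map_inj_uniq // => u v; apply: addmI.
move=> _ /mapP[u + ->]; rewrite inA inB => /mulU ->; exact: lem_addr.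
Qed.

(** Shift moves commute with multiplication. *)
Lemma shift_generates_mul (v w : 'X_{1..n.+1}) : shift_generates v w ->
  forall u, (u + v)%MM \in U -> (u + w)%MM \in U.
Proof.
elim=> [{}v {}w [u [i [j [ij -> ->]]]] u'|//|v1 v2 v3 _ IH1 _ IH2 u /IH1/IH2//].
rewrite !addmA ![(u' + U_(_))%MM]addmC -!addmA.
move: ij; rewrite leq_eqVlt => /predU1P[/val_inj -> //|ij]; exact: U_shifted.
Qed.

Lemma shift_generates_mdeg (v w : 'X_{1..n.+1}) : shift_generates v w -> mdeg v = mdeg w.
Proof.
elim=> [{}v {}w [u [i [j [_ -> ->]]]]|//|v1 v2 v3 _ -> _ ->//].
by rewrite !mdegD !mdeg1.
Qed.

Hypothesis G_gen : shift_generators G U.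

Lemma generators_mul j :
  (forall u, u \in degree_part G j -> (xm + u)%MM \in degree_part U j.+1) <->
  (forall u, u \in degree_part U j -> (xm + u)%MM \in degree_part U j.+1).
Proof.
split=> [mulG u|mulU u].
  rewrite (mem_degree_part j) => /andP[uU /eqP uj].
  have [v vG vu] := (G_gen u).1 uU.
  have vj := shift_generates_mdeg vu; have := mulG v.
  rewrite !mem_degree_part vG vj uj eqxx => /(_ isT)/andP[xvU _].
  by rewrite (shift_generates_mul vu) // mdegD mdeg1 uj add1n eqxx.
rewrite (mem_degree_part j) => /andP[uG uj]; apply: mulU.
rewrite mem_degree_part uj andbT; apply/(G_gen u).2; exists u => //; exact: rt_refl.
Qed.

Lemma bigmax_seqP (x0 : int) (s : seq int) :
  (\big[Order.max/x0]_(x <- s) x \in x0 :: s) /\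
  forall x, x \in s -> (x <= \big[Order.max/x0]_(x <- s) x)%R.
Proof.
elim: s => [|y s [IH1 IH2]]; first by rewrite big_nil mem_head.
rewrite big_cons; split.
  rewrite maxEle; case: ifP => _; last by rewrite !inE eqxx orbT.
  by move: IH1; rewrite !inE => /orP[->|->]; rewrite ?orbT.
by move=> x; rewrite inE le_max => /predU1P[->|/IH2 ->]; rewrite ?lexx ?orbT.
Qed.

Lemma first_peakP (s : seq int) : s != [::] ->
  [/\ (first_peak s < size s)%N,
      forall k, (k < size s)%N -> (s`_k <= s`_(first_peak s))%R
    & forall k, (k < first_peak s)%N -> (s`_k < s`_(first_peak s))%R].
Proof.
case: s => // x0 s _; rewrite /first_peak /=; set M := \big[_/_]_(x <- _) x.
have [Mmem Mmax] := bigmax_seqP x0 (x0 :: s); rewrite -/M in Mmem Mmax.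
have {}Mmem : M \in x0 :: s by move: Mmem; rewrite !inE orbA orbb.
have Mi : (index M (x0 :: s) < size (x0 :: s))%N by rewrite index_mem.
split=> // [k ks|k kM]; rewrite nth_index //; first exact/Mmax/mem_nth.
have ks := ltn_trans kM Mi.
rewrite lt_neqAle Mmax ?mem_nth // andbT; apply/eqP => kE.
by have := index_nth 0 ks; rewrite kE leqNgt kM.
Qed.

(** Once c vanishes it stays 0 and h decreases weakly; before that h increases weakly.
    At a degree above the peak alpha with c not 0, h would increase strictly beyond
    its maximum; at a degree up to alpha with c = 0, the maximum would already have
    been attained before. *)
Lemma lefschetz_conditions alpha :
  (alpha <= dmax U)%N -> (forall k, (k <= dmax U)%N -> (h k <= h alpha)%N) ->
  (forall k, (k < alpha)%N -> (h k < h alpha)%N) ->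
  (forall i, c i.+1 = 0%N \/ (c i.+1 + h i <= h i.+1)%N) <->
  (forall j, (alpha < j)%N -> forall u, u \in degree_part U j -> (xm <= u)%MM) /\
  (forall j, (0 < j <= alpha)%N -> forall u, u \in degree_part G j.-1 ->
     (xm + u)%MM \in degree_part U j).
Proof.
move=> ad hmax hlt.
have cS j : c j = 0%N -> c j.+1 = 0%N.
  move/hilb_last0 => div; apply/hilb_last0 => u; rewrite mem_degree_part => /andP[uU /eqP uj].
  have [Ucl _ _] := U_ideal; have [i iu ui] := mdegS_var uj.
  apply: lepm_trans (div (u - U_(i))%MM _) (lem_subr _ _).
  by rewrite mem_degree_part (Ucl _ _ uU (lem_subr _ _)) ui eqxx.
have cS' j k : (j <= k)%N -> c j = 0%N -> c k = 0%N.
  move=> jk c0; rewrite -(subnKC jk); elim: (k - j)%N => [|i]; first by rewrite addn0.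
  by rewrite addnS; apply: cS.
have hc i := proj1 (hilb_growth_step i).
have hmax' k : (h k <= h alpha)%N.
  by have [/hmax//|dk] := leqP k (dmax U); rewrite hilb_gt_dmax.
split=> [wl|[c1 c2] i].
  split=> [j aj|[//|j] /= ja]; last first.
    apply/generators_mul/(proj2 (hilb_growth_step j)); case: (wl j) => // c0.
    have : (h alpha <= h j)%N.
      rewrite -(subnKC ja); elim: (alpha - j.+1)%N => [|k IH].
        by rewrite addn0; have := hc j; rewrite c0.
      apply: leq_trans IH; rewrite addnS; have := hc (j.+1 + k)%N.
      by rewrite (cS' j.+1) // leqW // leq_addr.
    by rewrite leqNgt hlt.
  apply/hilb_last0; case: j aj => // j aj; case: (wl j) => // ci.
  apply/eqP/negPn/negP => cj.
  have mono : (h alpha <= h j)%N.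
    have step k : (k <= j)%N -> (h k <= h k.+1)%N.
      move=> kj; case: (wl k) => [ck|]; last exact: leq_trans (leq_addl _ _).
      by case/eqP: cj; apply: cS' ck.
    have := leqnn j; rewrite -{1 3}(subnKC (aj : alpha <= j)%N).
    elim: (j - alpha)%N => [|k IH] kj; first by rewrite addn0.
    rewrite addnS in kj *; apply: leq_trans (IH (ltnW kj)) _; exact: step (ltnW kj).
  by have := hmax' j.+1; move: ci cj; rewrite -lt0n; lia.
case: (leqP i.+1 alpha) => [ia|ai]; [right|left].
  by apply/(proj2 (hilb_growth_step i))/generators_mul => u uG; apply: (c2 i.+1).
by apply/hilb_last0; apply: c1.
Qed.

End Combinatorics.

(* P(m) with m = n.+1, so that x_m is U_(ord_max) *)
Theorem proposition4p8 (K : fieldType)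
    (K_infinite : forall s : seq K, exists x : K, x \notin s)
    (n : nat) (U : {fset 'X_{1..n.+1}}) (t : nat)
    (U_ideal : order_ideal U) (U_shifted : shifted U)
    (G : {fset 'X_{1..n.+1}}) (G_least : least_shift_generators G U) :
  let alpha := first_peak (squeezed_h U t) in
  weak_lefschetz (@stanley_reisner K _ (squeezed_complex U t)) <->
  (forall j : nat, (alpha < j)%N ->
     forall u, u \in degree_part U j -> (U_(ord_max) <= u)%MM) /\
  (forall j : nat, (0 < j <= alpha)%N ->
     forall u, u \in degree_part G j.-1 ->
       (U_(ord_max) + u)%MM \in degree_part U j).
Proof.
move=> alpha; have [G_gen _] := G_least.
pose N' := (n + t + dmax U)%N.
have N_def : N'.+1 = (n.+1 + t + dmax U)%N by [].
have Delta_def := squeezed_complexE U t.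
have hE k : (k <= dmax U)%N -> (squeezed_h U t)`_k = (hilb U n.+1 k)%:Z.
  move=> kd; rewrite /squeezed_h (nth_map 0%N) ?size_iota // nth_iota // add0n.
  by rewrite (h_entry_Delta U_ideal U_shifted (erefl _) Delta_def) // hilbE.
have sz : size (squeezed_h U t) = (dmax U).+1 by rewrite size_map size_iota.
have s0 : squeezed_h U t != [::] by rewrite -size_eq0 sz.
have [] := first_peakP s0.
rewrite sz ltnS -/alpha => ad amax alt.
have hmax k : (k <= dmax U)%N -> (hilb U n.+1 k <= hilb U n.+1 alpha)%N.
  by move=> kd; have := amax k kd; rewrite !hE.
have hlt k : (k < alpha)%N -> (hilb U n.+1 k < hilb U n.+1 alpha)%N.
  by move=> ka; have := alt k ka; rewrite !hE //; apply: leq_trans (ltnW ka) ad.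
apply: iff_trans (lefschetz_conditions U_ideal U_shifted G_gen ad hmax hlt).
split.
  exact: (hilb_of_lefschetz (N' := N') U_ideal U_shifted N_def Delta_def K_infinite).
exact: (lefschetz_of_hilb (N' := N') U_ideal U_shifted N_def Delta_def K_infinite).
Qed.
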